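(* Let $d\ge2$, $q\in[1,\infty)$, let $\mathcal X$ and $\mathcal Y$ be compact subsets of $\mathbb R^d$, let $M>0$, $\theta\in(0,1]$, and let $\rho_0\in\mathcal P(\mathcal X)$ satisfy $\rho_0(B_\eta(x))\le M\eta^{d-1+\theta}$ for every $x\in\mathbb R^d$ and $\eta>0$. Then for all $\rho_1\in\mathcal P(\mathcal X)$ and $\mu_0,\mu_1\in\mathcal P(\mathcal Y)$, and Brenier potentials $\phi_{\rho_i\to\mu_i}$ for the transport from $\rho_i$ to $\mu_i$ ($i=0,1$), $$\|\nabla\phi_{\rho_0\to\mu_0}-\nabla\phi_{\rho_1\to\mu_1}\|_{L^q(\rho_0)}^q\le C\Big(D_{\mathcal Y}W_1(\rho_0,\rho_1)+D_{\mathcal X}W_1(\mu_0,\mu_1)\Big)^{\frac{\theta}{1+\theta}},$$ where $C=D_{\mathcal Y}^{\,q}\left(1+c_dMD_{\mathcal X}^{d-1+\theta}\right)(D_{\mathcal Y}D_{\mathcal X})^{-\frac{\theta}{1+\theta}}$.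
   Context: $\mathcal P(E)$ is the set of Borel probability measures on $E$, and $B_\eta(x)$ is the open Euclidean ball. $D_{\mathcal X}=\operatorname{diam}(\mathcal X)$, $D_{\mathcal Y}=\operatorname{diam}(\mathcal Y)$. $\beta_k$ is the volume of the unit ball of $\mathbb R^k$ and $c_d=\frac43\,\frac{6^d d^2(d+1)\beta_d}{\beta_{d-1}}$. $W_1(\rho,\mu)=\min_{\gamma\in\Pi(\rho,\mu)}\int\|x-y\|\,d\gamma$, where $\Pi(\rho,\mu)$ is the set of couplings of $\rho$ and $\mu$. A Brenier potential for the transport from $\rho$ to $\mu$ is a minimiser $\phi$ of the dual problem $\inf_{\phi\text{ convex}}\int\phi\,d\rho+\int\phi^*\,d\mu$ (whose value equals $\sup_{\gamma\in\Pi(\rho,\mu)}\int\langle x,y\rangle\,d\gamma$). Standing convention: for $\rho\in\mathcal P(\mathcal X)$, $\mu\in\mathcal P(\mathcal Y)$, a Brenier potential $\phi:\mathbb R^d\to\mathbb R$ and its dual potential $\psi$ are always taken of the form $\phi(x)=\sup_{y\in\mathcal Y}\langle x,y\rangle-\psi(y)$ and $\psi(y)=\sup_{x\in\mathcal X}\langle x,y\rangle-\phi(x)$. The theorem applies to any Brenier potentials of this form. Under the condition on $\rho_0$, gradients of convex functions $\mathbb R^d\to\mathbb R$ are defined $\rho_0$-almost everywhere. *)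

(* Defs.v *)
From HB Require Import structures.
From mathcomp Require Import all_boot all_order all_algebra.
From mathcomp Require Import all_classical all_reals all_analysis.

Set Implicit Arguments.
Unset Strict Implicit.
Unset Printing Implicit Defensive.

Import Order.TTheory GRing.Theory Num.Theory.
Import numFieldNormedType.Exports.

Local Open Scope classical_set_scope.
Local Open Scope ring_scope.

(* Matrices, hence row vectors, carry their Borel sigma-algebra. *)
HB.instance Definition _ (R : realType) (m n : nat) :=
  Measurable.copy 'M[R]_(m, n) (g_sigma_algebraType (@open 'M[R]_(m, n))).

Section euclidean.
Context {R : realType} {d : nat}.
Implicit Types (x y : 'rV[R]_d) (A : set 'rV[R]_d) (f : 'rV[R]_d -> R).

Definition dotp x y : R := \sum_(i < d) x 0 i * y 0 i.

(* The library norm `|x| on row vectors is the sup norm. *)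
Definition enorm x : R := Num.sqrt (dotp x x).

Definition eball x (r : R) : set 'rV[R]_d := [set y | enorm (y - x) < r].

Definition ediam A : R := sup [set enorm (x - y) | x in A & y in A].

(* 'D_v f x is 0 where the limit does not exist. A convex f is differentiable
   wherever all its partial derivatives exist, so a default value is used only
   at points where f is not differentiable. *)
Definition gradient f x : 'rV[R]_d := \row_(i < d) 'D_(delta_mx 0 i) f x.

Definition fenchel_conjugate f y : \bar R :=
  ereal_sup [set (dotp x y - f x)%:E | x in [set: 'rV[R]_d]].

End euclidean.

(* On Borel sets, the product of k copies of the Lebesgue measure of R; the
   product of the library is a mere set function, so no proof is needed here. *)
Fixpoint lebesgue_rV {R : realType} (k : nat) : set 'rV[R]_k -> \bar R :=
  match k with
  | 0 => fun A => \d_(0 : 'rV[R]_0) A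
  | k'.+1 => fun A : set 'rV[R]_(1 + k') =>
      (@lebesgue_measure R \x @lebesgue_rV R k')%E
        [set p | A (row_mx p.1%:M p.2)]
  end.

Section transport.
Context {R : realType} {d : nat}.
Local Notation E := 'rV[R]_d.
Implicit Types (rho mu : probability E R) (X Y : set E) (phi : E -> R).

Definition coupling rho mu : set (probability (E * E)%type R) :=
  [set gamma | forall A : set E, measurable A ->
     pushforward gamma fst A = rho A /\ pushforward gamma snd A = mu A].

Definition W1 rho mu : \bar R :=
  ereal_inf [set (\int[gamma]_p (enorm (p.1 - p.2))%:E)%E
            | gamma in coupling rho mu].

Definition dual_functional rho mu phi : \bar R :=
  (\int[rho]_x (phi x)%:E + \int[mu]_y fenchel_conjugate phi y)%E.

(* The competitors are the finite convex functions: the conjugate of the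
   function constant to +oo is -oo and would make the functional meaningless. *)
Definition brenier_potential rho mu phi :=
  convex_function setT phi /\
  forall phi' : E -> R, convex_function setT phi' ->
    (dual_functional rho mu phi <= dual_functional rho mu phi')%E.

(* phi and psi are real-valued, so the suprema are required to be finite. *)
Definition dual_pair X Y phi (psi : E -> R) :=
  (forall x, (phi x)%:E = ereal_sup [set (dotp x y - psi y)%:E | y in Y]) /\
  (forall y, (psi y)%:E = ereal_sup [set (dotp x y - phi x)%:E | x in X]).

End transport.

Definition beta (R : realType) (k : nat) : R :=
  fine (lebesgue_rV (eball (0 : 'rV[R]_k) 1)).

Definition cst_c (R : realType) (d : nat) : R :=
  4 / 3 * (6 ^+ d * d%:R ^+ 2 * (d%:R + 1) * beta R d / beta R d.-1).

(* Main.v *)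
Require Import Defs.
From HB Require Import structures.
From mathcomp Require Import all_boot all_order all_algebra.
From mathcomp Require Import all_classical all_reals all_analysis.
From mathcomp Require Import measurable_realfun ring lra.
Import Order.TTheory GRing.Theory Num.Theory.
Import numFieldNormedType.Exports.
Set Implicit Arguments.
Unset Strict Implicit.
Unset Printing Implicit Defensive.
Local Open Scope classical_set_scope.
Local Open Scope ring_scope.

(** Write D_X, D_Y for the diameters, E for D_Y W1(rho0, rho1) + D_X W1(mu0, mu1),
    Phi for phi0 + phi1, and s_x(v) for the second difference
    Phi(x + v) + Phi(x - v) - 2 Phi(x).

    Both potentials are compared with the conjugate h over Y of (psi0 + psi1)/2,
    h(x) = sup_(y in Y) <x, y> - (psi0(y) + psi1(y))/2. It is a competitor
    of phi0 in the dual problem of (rho0, mu0), and phi0 is a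
    competitor of phi1 in that of (rho1, mu1). Adding
    the two optimality inequalities leaves integrals of phi1 - phi0 and psi1 - psi0
    against rho0 - rho1 and mu0 - mu1; these functions are D_Y- and D_X-Lipschitz,
    so the nonnegative function G = phi0 + phi1 - 2h satisfies
    int G drho0 <= E ([stability_gap]).

    Pointwise, 2h(x) <= phi0(x - v) + phi1(x + v) for every v. If p0 and p1 are
    subgradients of phi0 and phi1 at x, and v has length r and the direction of
    p0 - p1, the subgradient inequalities at x - v and x + v, combined with the
    midpoint inequality, give r |p0 - p1| <= G(x) + s_x(v).

    The second differences of a convex function are small in the mean with respect
    to a measure that gives balls of radius r a mass at most M r^(d-1+theta):
    there is H with s_x(v) <= r H(x) for |v| <= r, and with int H drho0 at most a
    constant times M D_Y D_X^(d-1) r^theta ([second_diff_integral_bound]). The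
    proof is discrete. For a point c of a fine lattice within r of x, s_x(v) is
    at most 2/d times the sum of the second differences at c with step 2dr in the
    coordinate directions ([second_diff_le_axes]). Averaging over the lattice
    points near x and integrating, each lattice point is weighted by the mass of
    one ball. The sum along a lattice line telescopes to a slope difference, and
    so is bounded by the diameter of the set of slopes
    ([sum_second_diff_column]). Finally the number of lattice lines is compared
    with the number of lattice points in a ball by dividing by an integer and rounding
    ([card_cylinder_le]). Working with balls rather than cubes keeps the constant
    exponential in d, which leaves it below c_d because the slices of the unit
    ball give beta_d / beta_(d-1) >= (5/6)^(d-1) ([beta_ratio_ge]).

    The same estimate with r -> 0 shows that rho0-almost everywhere the partial
    derivatives exist, so that the gradients are the subgradients p0 and p1
    ([ae_gradient]). Hence the integral of |p0 - p1| is at most E / r plus a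
    constant times r^theta; the choice of r that balances the two terms gives the
    exponent theta / (1 + theta). Larger values of q cost a factor D_Y^(q-1)
    since the gradients lie in Y. *)

(** * Euclidean geometry of row vectors *)

Lemma dotpC (R : realType) (d : nat) (x y : 'rV[R]_d) : dotp x y = dotp y x.
Proof. by apply: eq_bigr => i _; rewrite mulrC. Qed.

Lemma dotpDl (R : realType) (d : nat) (x y z : 'rV[R]_d) :
  dotp (x + y) z = dotp x z + dotp y z.
Proof. by rewrite -big_split; apply: eq_bigr => i _; rewrite mxE mulrDl. Qed.

Lemma dotpNl (R : realType) (d : nat) (x z : 'rV[R]_d) :
  dotp (- x) z = - dotp x z.
Proof. by rewrite -sumrN; apply: eq_bigr => i _; rewrite mxE mulNr. Qed.

Lemma dotpBl (R : realType) (d : nat) (x y z : 'rV[R]_d) :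
  dotp (x - y) z = dotp x z - dotp y z.
Proof. by rewrite dotpDl dotpNl. Qed.

Lemma dotpZl (R : realType) (d : nat) (a : R) (x z : 'rV[R]_d) :
  dotp (a *: x) z = a * dotp x z.
Proof. by rewrite mulr_sumr; apply: eq_bigr => i _; rewrite mxE mulrA. Qed.

Lemma dotpDr (R : realType) (d : nat) (x y z : 'rV[R]_d) :
  dotp z (x + y) = dotp z x + dotp z y.
Proof. by rewrite dotpC dotpDl !(dotpC z). Qed.

Lemma dotpBr (R : realType) (d : nat) (x y z : 'rV[R]_d) :
  dotp z (x - y) = dotp z x - dotp z y.
Proof. by rewrite dotpC dotpBl !(dotpC z). Qed.

Lemma dotpZr (R : realType) (d : nat) (a : R) (x z : 'rV[R]_d) :
  dotp z (a *: x) = a * dotp z x.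
Proof. by rewrite dotpC dotpZl dotpC. Qed.

Lemma dotp0l (R : realType) (d : nat) (x : 'rV[R]_d) : dotp 0 x = 0.
Proof. by rewrite /dotp big1// => i _; rewrite mxE mul0r. Qed.

Lemma dotp_delta (R : realType) (d : nat) (i : 'I_d) (x : 'rV[R]_d) :
  dotp (delta_mx 0 i) x = x 0 i.
Proof.
rewrite /dotp (bigD1 i)//= big1 => [|j ji]; first by rewrite mxE !eqxx mul1r addr0.
by rewrite mxE eqxx (negbTE ji) mul0r.
Qed.

Lemma dotpxx_ge0 (R : realType) (d : nat) (x : 'rV[R]_d) : 0 <= dotp x x.
Proof. by apply: sumr_ge0 => i _; rewrite -expr2 sqr_ge0. Qed.

Lemma enorm_ge0 (R : realType) (d : nat) (x : 'rV[R]_d) : 0 <= enorm x.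
Proof. exact: sqrtr_ge0. Qed.

Lemma sqr_enorm (R : realType) (d : nat) (x : 'rV[R]_d) :
  enorm x ^+ 2 = dotp x x.
Proof. by rewrite sqr_sqrtr// dotpxx_ge0. Qed.

Lemma enorm0 (R : realType) (d : nat) : enorm (0 : 'rV[R]_d) = 0.
Proof. by rewrite /enorm dotp0l sqrtr0. Qed.

Lemma enorm_eq0 (R : realType) (d : nat) (x : 'rV[R]_d) :
  enorm x = 0 -> x = 0.
Proof.
move=> x0; have := sqr_enorm x; rewrite x0 expr0n /= => /esym/eqP.
rewrite psumr_eq0 => [/allP h|i _]; last by rewrite -expr2 sqr_ge0.
apply/rowP => i; rewrite mxE; apply/eqP.
by have := h i (mem_index_enum _); rewrite mulf_eq0 orbb.
Qed.

Lemma enormZ (R : realType) (d : nat) (a : R) (x : 'rV[R]_d) :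
  enorm (a *: x) = `|a| * enorm x.
Proof.
by rewrite /enorm dotpZl dotpZr mulrA -expr2 sqrtrM ?sqr_ge0// sqrtr_sqr.
Qed.

Lemma enormN (R : realType) (d : nat) (x : 'rV[R]_d) : enorm (- x) = enorm x.
Proof. by rewrite -scaleN1r enormZ normrN1 mul1r. Qed.

Lemma enormB (R : realType) (d : nat) (x y : 'rV[R]_d) :
  enorm (x - y) = enorm (y - x).
Proof. by rewrite -enormN opprB. Qed.

Lemma cauchy_schwarz (R : realType) (d : nat) (x y : 'rV[R]_d) :
  dotp x y <= enorm x * enorm y.
Proof.
have [x0|xn0] := eqVneq (enorm x) 0.
  by rewrite (enorm_eq0 x0) dotp0l enorm0 mul0r.
have [y0|yn0] := eqVneq (enorm y) 0.
  by rewrite (enorm_eq0 y0) dotpC dotp0l enorm0 mulr0.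
have xp : 0 < enorm x by rewrite lt_neqAle eq_sym xn0 enorm_ge0.
have yp : 0 < enorm y by rewrite lt_neqAle eq_sym yn0 enorm_ge0.
have := dotpxx_ge0 (enorm y *: x - enorm x *: y).
rewrite dotpBl !dotpBr !dotpZl !dotpZr -!sqr_enorm (dotpC y x).
set a := enorm x; set b := enorm y; set c := dotp x y => h.
have ab : 0 < a * b by rewrite mulr_gt0.
rewrite -subr_ge0 -(pmulr_rge0 _ ab).
by move: h; nra.
Qed.

Lemma enormD (R : realType) (d : nat) (x y : 'rV[R]_d) :
  enorm (x + y) <= enorm x + enorm y.
Proof.
rewrite -(@ler_pXn2r _ 2)// ?nnegrE ?addr_ge0 ?enorm_ge0//.
rewrite sqr_enorm dotpDl !dotpDr -!sqr_enorm (dotpC y x).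
by have := cauchy_schwarz x y; nra.
Qed.

Lemma enormB_le (R : realType) (d : nat) (x y : 'rV[R]_d) :
  enorm (x - y) <= enorm x + enorm y.
Proof. by rewrite -(enormN y) enormD. Qed.

Lemma coord_le_enorm (R : realType) (d : nat) (x : 'rV[R]_d) (i : 'I_d) :
  `|x 0 i| <= enorm x.
Proof.
rewrite -(@ler_pXn2r _ 2)// ?nnegrE ?enorm_ge0// sqr_enorm real_normK ?num_real//.
rewrite /dotp (bigD1 i)//= -expr2 lerDl sumr_ge0// => j _.
by rewrite -expr2 sqr_ge0.
Qed.

Lemma enorm_le_coord (R : realType) (d : nat) (x : 'rV[R]_d) (a : R) :
  0 <= a -> (forall i, `|x 0 i| <= a) -> enorm x <= d%:R * a.
Proof.
move=> a0 h; rewrite -(@ler_pXn2r _ 2)// ?nnegrE ?enorm_ge0 ?mulr_ge0//.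
rewrite sqr_enorm (@le_trans _ _ (\sum_(i < d) a ^+ 2))//.
  apply: ler_sum => i _; rewrite -expr2 -[x 0 i ^+ 2]real_normK ?num_real//.
  by rewrite ler_pXn2r// nnegrE.
rewrite sumr_const card_ord exprMn -[X in X <= _]mulr_natl ler_wpM2r ?sqr_ge0//.
by rewrite -natrX ler_nat; case: (d) => // n; rewrite expnS leq_pmulr// expn_gt0.
Qed.

(** * Second differences of convex functions *)

Definition subgradient (R : realType) (d : nat) (f : 'rV[R]_d -> R)
    (c p : 'rV[R]_d) :=
  forall x, f c + dotp (x - c) p <= f x.

Definition second_diff (R : realType) (d : nat) (f : 'rV[R]_d -> R)
    (x v : 'rV[R]_d) : R :=
  f (x + v) + f (x - v) - 2 * f x.

Lemma second_diff_ge0 (R : realType) (d : nat) (f : 'rV[R]_d -> R)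
    (x p v : 'rV[R]_d) :
  subgradient f x p -> 0 <= second_diff f x v.
Proof.
move=> hp; have := hp (x + v); have := hp (x - v).
have -> : x - v - x = - v by rewrite addrAC subrr add0r.
have -> : x + v - x = v by rewrite addrAC subrr add0r.
rewrite dotpNl /second_diff; lra.
Qed.

Lemma second_diffN (R : realType) (d : nat) (f : 'rV[R]_d -> R)
    (x v : 'rV[R]_d) :
  second_diff f x (- v) = second_diff f x v.
Proof. by rewrite /second_diff opprK (addrC (f (x - v))). Qed.

(** Let q be a subgradient at c + w. Its inequality at c + sign(w_i) L e_i and that
    of p at c - sign(w_i) L e_i bound the i-th second difference from below;
    weighting by |w_i| / L makes the terms in q cancel up to a term that is
    favourable because the weights sum to at most 1. Geometrically, c + w is a
    convex combination of c and the vertices of a cross-polytope of radius L. *)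
Lemma le_cross_polytope (R : realType) (d : nat) (f : 'rV[R]_d -> R)
    (hf : forall c, exists p, subgradient f c p) (c p w : 'rV[R]_d) (L : R) :
  subgradient f c p -> 0 < L -> \sum_(i < d) `|w 0 i| <= L ->
  f (c + w) <= f c + dotp w p
    + \sum_(i < d) `|w 0 i| / L * second_diff f c (L *: delta_mx 0 i).
Proof.
move=> hp L0 hw; have [q hq] := hf (c + w).
pose u := f (c + w) - f c - dotp w q.
have u0 : u <= 0.
  have := hq c; rewrite (_ : c - (c + w) = - w); last by rewrite opprD addNKr.
  by rewrite dotpNl /u; lra.
have key (i : 'I_d) : `|w 0 i| / L * u + w 0 i * (q 0 i - p 0 i) <=
    `|w 0 i| / L * second_diff f c (L *: delta_mx 0 i).
  have [s [s2 sw]] : exists s : R, (s = 1 \/ s = -1) /\ `|w 0 i| = s * w 0 i.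
    have [h|h] := leP 0 (w 0 i).
      by exists 1; split; [left|rewrite mul1r ger0_norm].
    by exists (-1); split; [right|rewrite mulN1r ltr0_norm].
  have -> : second_diff f c (L *: delta_mx 0 i) =
            second_diff f c ((s * L) *: delta_mx 0 i).
    case: s2 => ->; first by rewrite mul1r.
    by rewrite mulN1r scaleNr second_diffN.
  set v := _ *: delta_mx 0 i.
  have v1 : dotp v p = s * L * p 0 i by rewrite dotpZl dotp_delta.
  have v2 : dotp v q = s * L * q 0 i by rewrite dotpZl dotp_delta.
  have h1 := hq (c + v); have h2 := hp (c - v).
  rewrite (_ : c + v - (c + w) = v - w) in h1; last by rewrite opprD addrACA subrr add0r.
  rewrite (_ : c - v - c = - v) in h2; last by rewrite addrAC subrr add0r.
  rewrite dotpBl v2 in h1; rewrite dotpNl v1 in h2.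
  have h3 : u + s * L * (q 0 i - p 0 i) <= second_diff f c v.
    by rewrite /second_diff /u; lra.
  have a0 : 0 <= `|w 0 i| / L by rewrite divr_ge0// ltW.
  apply: le_trans (ler_wpM2l a0 h3).
  rewrite [leRHS]mulrDr lerD2l {}sw.
  rewrite (_ : s * w 0 i / L * (s * L * (q 0 i - p 0 i)) =
    (s * s) * (w 0 i * (q 0 i - p 0 i))); last by field; rewrite gt_eqF.
  by case: s2 => ->; rewrite ?mulrNN mulr1 mul1r.
have := @ler_sum _ _ (index_enum 'I_d) predT _ _ (fun i _ => key i).
rewrite big_split /= -mulr_suml.
have -> : \sum_(i < d) w 0 i * (q 0 i - p 0 i) = dotp w q - dotp w p.
  by rewrite -dotpBr; apply: eq_bigr => i _; rewrite !mxE.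
set S := \sum_(i < d) _ * second_diff _ _ _.
rewrite -mulr_suml; set A := \sum_(i < d) `|w 0 i| in hw *.
have : u <= A / L * u.
  rewrite -[leLHS]mul1r ler_wnM2r// ler_pdivrMr// mul1r//.
rewrite /u; lra.
Qed.

(** The point of moving from x to a nearby c is that the right-hand side can be
    sampled on a lattice. Subtracting the affine function given by a subgradient
    at c changes no second difference, so that both x + v and x - v can be treated
    by [le_cross_polytope]. The step 2dr is large enough since |x - c + v|, |x - c - v|
    are at most 2r and the l^1 norm is at most d times the Euclidean norm. *)
Lemma second_diff_le_axes (R : realType) (d : nat) (f : 'rV[R]_d.+1 -> R)
    (hf : forall c, exists p, subgradient f c p) (c x v : 'rV[R]_d.+1) (r : R) :
  0 < r -> enorm (x - c) <= r -> enorm v <= r ->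
  second_diff f x v <= 2 / d.+1%:R *
    \sum_(i < d.+1) second_diff f c ((2 * d.+1%:R * r) *: delta_mx 0 i).
Proof.
move=> r0 xc vr; have [p hp] := hf c.
set L := 2 * d.+1%:R * r.
have L0 : 0 < L by rewrite !mulr_gt0// ltr0n.
have step w : enorm w <= 2 * r -> f (c + w) <= f c + dotp w p
    + d.+1%:R^-1 * \sum_(i < d.+1) second_diff f c (L *: delta_mx 0 i).
  move=> wr; have wi i : `|w 0 i| <= 2 * r.
    exact: le_trans (coord_le_enorm _ _) wr.
  apply: le_trans (le_cross_polytope hf hp L0 _) _.
    apply: (@le_trans _ _ (\sum_(i < d.+1) 2 * r)); first exact: ler_sum.
    by rewrite sumr_const card_ord -mulr_natl /L; lra.
  rewrite lerD2l mulr_sumr; apply: ler_sum => i _; apply: ler_wpM2r.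
    exact: second_diff_ge0 hp.
  rewrite ler_pdivrMr// (_ : _^-1 * L = 2 * r)// /L.
  by move: (ltr0Sn R d); move: (d.+1%:R) => D D0; field; rewrite gt_eqF.
have h1 := step (x - c + v); have h2 := step (x - c - v).
have /h1 {}h1 : enorm (x - c + v) <= 2 * r.
  by apply: le_trans (enormD _ _) _; lra.
have /h2 {}h2 : enorm (x - c - v) <= 2 * r.
  by apply: le_trans (enormB_le _ _) _; lra.
have e1 : c + (x - c + v) = x + v by rewrite addrA (addrC c) subrK.
have e2 : c + (x - c - v) = x - v by rewrite addrA (addrC c) subrK.
rewrite e1 dotpDl in h1; rewrite e2 dotpBl in h2.
rewrite -(mulrA 2); move: h1 h2 (hp x); rewrite /second_diff -/L.
by set S := _ * \sum_(_ < _) _; lra.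
Qed.

(** Both sides are the sum of g over an interval of length m + n, less the sums over
    its first m and its first n terms. *)
Lemma sum_shift_diff (V : zmodType) (g : nat -> V) (m n : nat) :
  \sum_(k < n) (g (k + m)%N - g k) = \sum_(k < m) (g (k + n)%N - g k).
Proof.
have sh p q : \sum_(k < p) g (k + q)%N = \sum_(q <= k < q + p) g k.
  by rewrite -[in RHS](add0n q) big_addn add0n addKn big_mkord.
have sh0 p : \sum_(k < p) g k = \sum_(0 <= k < p) g k by rewrite big_mkord.
rewrite !sumrB; apply/eqP; rewrite subr_eq addrAC eq_sym subr_eq; apply/eqP.
rewrite !sh !sh0 addrC -big_cat_nat ?leq_addr//= addrC -big_cat_nat ?leq_addr//.
by rewrite addnC.
Qed.

(** With g(k) the increment of f over the step that ends at the k-th point, the k-th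
    second difference is g(k + m) - g(k). The sum telescopes to m differences of
    increments, whatever the number n of points. *)
Lemma sum_second_diff_column (R : realType) (d : nat) (f : 'rV[R]_d -> R)
    (B : R) (i : 'I_d) (a : 'rV[R]_d) (e : R) (m n : nat) :
  (forall x y L, 0 <= L -> f (x + L *: delta_mx 0 i) - f x
     - (f (y + L *: delta_mx 0 i) - f y) <= L * B) ->
  0 <= e ->
  \sum_(k < n) second_diff f (a + (k%:R * e) *: delta_mx 0 i)
    ((m%:R * e) *: delta_mx 0 i) <= m%:R * (m%:R * e * B).
Proof.
move=> hB e0; set L := m%:R * e; set ei := delta_mx 0 i.
have L0 : 0 <= L by rewrite mulr_ge0.
pose c (k : nat) := a + (k%:R * e) *: ei.
pose g k := f (c k) - f (c k - L *: ei).
have cm k : c k + L *: ei = c (k + m)%N.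
  by rewrite /c -addrA -scalerDl natrD mulrDl.
have E (k : nat) : second_diff f (c k) (L *: ei) = g (k + m)%N - g k.
  by rewrite /second_diff /g -cm addrK; lra.
under eq_bigr do rewrite E.
have -> : \sum_(k < n) (g (k + m)%N - g k) = \sum_(k < m) (g (k + n)%N - g k).
  exact: sum_shift_diff.
have -> : m%:R * (L * B) = \sum_(k < m) L * B.
  by rewrite sumr_const card_ord mulr_natl.
apply: ler_sum => k _; rewrite /g.
have := hB (c (k + n)%N - L *: ei) (c k - L *: ei) L L0.
by rewrite !subrK.
Qed.

(** * Counting lattice points *)

(** The lattice points are indexed by a finite box centred at Q, so that all
    sums below are finite. *)
Definition grid_offset (R : realType) (d P : nat) (e : R) (Q : nat)
    (z : {ffun 'I_d -> 'I_P}) : 'rV[R]_d :=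
  \row_l (e * ((z l)%:R - Q%:R)).

Definition erase (R : realType) (d : nat) (i : 'I_d) (x : 'rV[R]_d) : 'rV[R]_d :=
  \row_l (if l == i then 0 else x 0 l).

Lemma sqr_enorm_erase (R : realType) (d : nat) (i : 'I_d) (x : 'rV[R]_d) :
  enorm x ^+ 2 = enorm (erase i x) ^+ 2 + x 0 i ^+ 2.
Proof.
rewrite !sqr_enorm /dotp (bigD1 i)//= [in RHS](bigD1 i)//= !mxE eqxx mulr0 add0r.
rewrite addrC -expr2; congr (_ + _); apply: eq_bigr => l li.
by rewrite !mxE (negbTE li).
Qed.

Lemma enorm_erase_le (R : realType) (d : nat) (i : 'I_d) (x : 'rV[R]_d) :
  enorm (erase i x) <= enorm x.
Proof.
rewrite -(@ler_pXn2r _ 2)// ?nnegrE ?enorm_ge0//.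
by rewrite [leRHS](sqr_enorm_erase i) lerDl sqr_ge0.
Qed.

(** Rounding each coordinate of z / j maps the cylinder of radius 2D around the
    i-th axis into the ball of radius r around x: transversally 2D / j <= r / 2,
    the length of the box is j times r, and the rounding error is small because the
    spacing e is r / 8d. The quotients and the remainders modulo j determine z, so
    that at most j ^ d points of the cylinder share an image. *)
Lemma card_cylinder_le (R : realType) (d : nat) (hd : (0 < d)%N)
    (x0 x : 'rV[R]_d) (D r : R) (e : R) (j P Q : nat) (i : 'I_d) :
  0 < r -> r <= D -> enorm (x - x0) <= D -> 4 * D <= r * j%:R ->
  P = (8 * d * j)%N -> Q = (4 * d * j)%N -> e * (8 * d%:R) = r ->
  (#|[pred z : {ffun 'I_d -> 'I_P} |
        (enorm (erase i (grid_offset e Q z)) < 2 * D)%R]|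
   <= #|[pred z : {ffun 'I_d -> 'I_P} |
        (enorm (x0 + grid_offset e Q z - x) < r)%R]| * j ^ d)%N.
Proof.
move=> r0 rD xD Dj hP hQ ed.
have d0 : 0 < d%:R :> R by rewrite ltr0n.
have d1 : 1 <= d%:R :> R by rewrite ler1n.
have D0 : 0 < D by exact: lt_le_trans rD.
have e0 : 0 < e by rewrite -(@pmulr_lgt0 _ (8 * d%:R)) ?ed// mulr_gt0.
have j0 : 0 < j%:R :> R by rewrite -(pmulr_rgt0 _ r0); apply: lt_le_trans Dj; lra.
have j0' : (0 < j)%N by rewrite -(ltr0n R).
pose A (l : 'I_d) : int := Num.floor ((x - x0) 0 l / e).
(* U z l - Q is the rounded value of (z l - Q) / j, shifted by the rounded position
   A l of x; its computation as an integer excludes truncated subtraction. *)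
pose U (z : {ffun 'I_d -> 'I_P}) (l : 'I_d) : int :=
  ((z l %/ j)%N%:Z - (4 * d)%N%:Z + Q%:Z + A l)%R.
pose u (z : {ffun 'I_d -> 'I_P}) : {ffun 'I_d -> 'I_P} := [ffun l => insubd (z l) (absz (U z l))].
pose rem (z : {ffun 'I_d -> 'I_P}) : {ffun 'I_d -> 'I_j} :=
  [ffun l => Ordinal (ltn_pmod (z l : 'I_P) j0')].
pose W := [pred z : {ffun 'I_d -> 'I_P} |
        (enorm (erase i (grid_offset e Q z)) < 2 * D)%R].
have errb z l : - (2 * e) <= e * ((U z l)%:~R - Q%:R) - (x - x0) 0 l
    - j%:R^-1 * (e * ((z l)%:R - Q%:R)) <= 0.
  have hA1 : (A l)%:~R * e <= (x - x0) 0 l by rewrite -ler_pdivlMr// ge_floor.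
  have hA2 : (x - x0) 0 l < (A l)%:~R * e + e.
    have := floorD1_gt ((x - x0) 0 l / e).
    by rewrite intrD ltr_pdivrMr// mulrDl mul1r.
  have zj : (z l)%:R = (z l %/ j)%:R * j%:R + (z l %% j)%:R :> R.
    by rewrite -natrM -natrD -divn_eq.
  have m1 : (z l %% j)%:R < j%:R :> R by rewrite ltr_nat ltn_pmod.
  have m0 : 0 <= (z l %% j)%:R :> R by [].
  have QE : Q%:R = 4 * d%:R * j%:R :> R by rewrite hQ !natrM.
  rewrite /U !intrD intrN -!pmulrn natrM.
  rewrite [X in _ - X](_ : _ =
     e * ((z l %/ j)%:R + (z l %% j)%:R / j%:R - 4 * d%:R)); last first.
    by rewrite zj QE; field; rewrite gt_eqF.
  have q0 : 0 <= (z l %% j)%:R / j%:R :> R by rewrite divr_ge0.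
  have q1 : (z l %% j)%:R / j%:R <= 1 :> R by rewrite ler_pdivrMr// mul1r ltW.
  move: hA1 hA2; set t := _ / _ in q0 q1 *; set w := (z l %/ j)%:R.
  have et0 : 0 <= e * t by rewrite mulr_ge0// ltW.
  have et1 : e * t <= e by rewrite ler_piMr// ltW.
  by lra.
have nearx z : W z -> enorm (\row_l (e * ((U z l)%:~R - Q%:R)) - (x - x0)) < r.
  move=> Wz; pose g := grid_offset e Q z.
  rewrite (_ : _ - _ = j%:R^-1 *: g +
    (\row_l (e * ((U z l)%:~R - Q%:R)) - (x - x0) - j%:R^-1 *: g)); last first.
    by rewrite [RHS]addrC subrK.
  apply: le_lt_trans (enormD _ _) _.
  have h2 : enorm (\row_l (e * ((U z l)%:~R - Q%:R)) - (x - x0) - j%:R^-1 *: g)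
      <= d%:R * (2 * e).
    apply: enorm_le_coord => [|l]; first by lra.
    have := errb z l; rewrite !mxE ler_norml; lra.
  have h1 : enorm (j%:R^-1 *: g) < 3 / 4 * r.
    rewrite enormZ ger0_norm ?invr_ge0 ?ltW//.
    rewrite mulrC ltr_pdivrMr// -mulrA; set b := r * j%:R in Dj *.
    have b0 : 0 < b by exact: mulr_gt0.
    rewrite -(@ltr_pXn2r _ 2)// ?nnegrE ?enorm_ge0 ?(ltW b0) ?mulr_ge0 ?invr_ge0
      ?(ltW r0) ?(ltW j0)//.
    rewrite (sqr_enorm_erase i).
    have a1 : enorm (erase i g) ^+ 2 <= (2 * D) ^+ 2.
      by rewrite ler_pXn2r// ?nnegrE ?enorm_ge0 ?mulr_ge0 ?(ltW D0)// ltW.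
    have a2 : g 0 i ^+ 2 <= (b / 2) ^+ 2.
      rewrite -[g 0 i ^+ 2]real_normK ?num_real//.
      rewrite ler_pXn2r // ?nnegrE ?divr_ge0 ?(ltW b0)//.
      have -> : b / 2 = e * Q%:R.
        by rewrite /b -ed hQ !natrM; field.
      rewrite mxE normrM (gtr0_norm e0) ler_pM2l// ler_norml.
      have zP : (z i)%:R <= P%:R :> R by rewrite ler_nat ltnW.
      have PQ : P%:R = 2 * Q%:R :> R by rewrite -natrM hP hQ !mulnA.
      have z0 : 0 <= (z i)%:R :> R by [].
      lra.
    have a3 : (4 * D) ^+ 2 <= b ^+ 2.
      by rewrite ler_pXn2r // ?nnegrE ?(ltW b0) ?mulr_ge0 ?(ltW D0)//.
    have a4 : 0 < b ^+ 2 by rewrite exprn_gt0.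
    by move: a1 a2 a3 a4; rewrite !exprMn !exprVn; lra.
  have h3 : d%:R * (2 * e) = r / 4 by rewrite -ed; field.
  move: h1 h2; rewrite h3; lra.
have Ubd z l : W z -> (0 <= (U z l)%:~R :> R) && ((U z l)%:~R < P%:R :> R).
  move=> Wz; have h := nearx z Wz.
  have := le_lt_trans (coord_le_enorm _ l) (le_lt_trans (enormD _ (x - x0))
    (ltr_leD h xD)).
  rewrite subrK mxE normrM (gtr0_norm e0) => {}h.
  have {}h : `|(U z l)%:~R - Q%:R| < Q%:R :> R.
    rewrite -(ltr_pM2l e0); apply: lt_le_trans h _.
    have -> : e * Q%:R = r * j%:R / 2 by rewrite -ed hQ !natrM; field.
    lra.
  have PQ : P%:R = 2 * Q%:R :> R by rewrite -natrM hP hQ !mulnA.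
  by move: h; rewrite PQ ltr_norml => /andP[? ?]; apply/andP; split; lra.
have uE z l : W z -> (u z l : nat)%:Z = U z l.
  move=> Wz; have /andP[U0 UP] := Ubd z l Wz.
  have U0' : 0 <= U z l by rewrite -(ler0z R).
  rewrite ffunE val_insubd ifT ?gez0_abs//.
  by rewrite -(ltr_nat R) [X in X < _]pmulrn gez0_abs.
have inj : {in W &, injective (fun z => (u z, rem z))}.
  move=> z z' Wz Wz' [uu rr]; apply/ffunP => l; apply/val_inj => /=.
  have := congr1 (fun f : {ffun _ -> 'I_P} => (f l : nat)%:Z) uu; rewrite !uE//.
  have := congr1 (fun f : {ffun _ -> 'I_j} => (f l : nat)) rr; rewrite !ffunE /=.
  rewrite /U => h1 h2; rewrite (divn_eq (z l) j) (divn_eq (z' l) j) h1.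
  by move/addIr/addIr/addIr: h2 => [->].
have -> : (j ^ d = #|{ffun 'I_d -> 'I_j}|)%N by rewrite card_ffun !card_ord.
rewrite -cardX -(card_in_image inj).
apply: subset_leq_card; apply/fintype.subsetP => _ /fintype.imageP[z Wz ->].
rewrite inE /= inE andbT.
rewrite (_ : x0 + _ - x = \row_l (e * ((U z l)%:~R - Q%:R)) - (x - x0)).
  exact: nearx.
apply/rowP => l; rewrite !mxE -(uE z l Wz) -pmulrn; lra.
Qed.

Definition set_coord (d P : nat) (i : 'I_d) (z : {ffun 'I_d -> 'I_P}) (k : 'I_P)
    : {ffun 'I_d -> 'I_P} :=
  [ffun l => if l == i then k else z l].

(** Exchanging k with the i-th coordinate of z is an involution of the pairs
    (z, k). This avoids choosing a representative of each lattice line. *)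
Lemma sum_columns (V : nmodType) (d P : nat) (i : 'I_d)
    (W : pred {ffun 'I_d -> 'I_P}) (F : {ffun 'I_d -> 'I_P} -> V) :
  (forall z k, W (set_coord i z k) = W z) ->
  \sum_(z | W z) \sum_(k < P) F (set_coord i z k) = (\sum_(z | W z) F z) *+ P.
Proof.
move=> hW; rewrite pair_big_dep /=.
pose h (p : {ffun 'I_d -> 'I_P} * 'I_P) := (set_coord i p.1 p.2, p.1 i).
have hK : involutive h.
  move=> [z k]; rewrite /h /=; congr pair; last by rewrite ffunE eqxx.
  by apply/ffunP => l; rewrite !ffunE; case: eqP => // ->.
rewrite (reindex_inj (inv_inj hK)) /=.
transitivity (\sum_(p : {ffun 'I_d -> 'I_P} * 'I_P | W p.1 && true) F p.1).
  apply: eq_big => [[z k]|[z k] _] /=; first by rewrite hW.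
  by congr F; apply/ffunP => l; rewrite !ffunE; case: eqP => // ->.
rewrite -(pair_big_dep W (fun _ _ => true) (fun z _ => F z)) /= -sumrMnl.
by apply: eq_bigr => z _; rewrite sumr_const card_ord.
Qed.

(** * Borel measurability on row vectors *)

Lemma coord_le_mx_norm (R : realType) (d : nat) (x : 'rV[R]_d) (i : 'I_d) :
  `|x 0 i| <= `|x|.
Proof.
have := @mx_normrE R 1 d x; rewrite /Num.norm /= => ->.
exact: (le_bigmax _ (fun k => `|x k.1 k.2|) (0, i)).
Qed.

Lemma enorm_le_norm (R : realType) (d : nat) (x : 'rV[R]_d) :
  enorm x <= d%:R * `|x|.
Proof. by apply: enorm_le_coord => // i; exact: coord_le_mx_norm. Qed.

Lemma enorm_lipschitz_continuous (R : realType) (d : nat) (f : 'rV[R]_d -> R)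
    (K : R) :
  (forall x y, f x - f y <= K * enorm (x - y)) -> continuous f.
Proof.
move=> hf x; apply/(@cvgrPdist_lt _ _ _ (nbhs x)) => e e0.
have K0 : 0 < `|K| * d%:R + 1 by rewrite ltr_wpDl// mulr_ge0.
near=> t.
have xt : `|x - t| < e / (`|K| * d%:R + 1).
  by near: t; apply: (@cvgr_dist_lt _ _ _ _ _ id x); [exact: cvg_id|rewrite divr_gt0].
have key y z : f y - f z <= `|K| * d%:R * `|y - z|.
  apply: le_trans (hf _ _) _; rewrite -mulrA.
  apply: le_trans (ler_wpM2r (enorm_ge0 _) (ler_norm K)) _.
  by rewrite ler_wpM2l// enorm_le_norm.
apply: (@le_lt_trans _ _ (`|K| * d%:R * `|x - t|)).
  by rewrite ler_norml key andbT lerNl opprB (le_trans (key _ _))// distrC.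
rewrite ltr_pdivlMr// in xt; apply: le_lt_trans xt.
by rewrite mulrC ler_wpM2l// lerDl.
Unshelve. all: by end_near. Qed.

Lemma continuous_rV_measurable (R : realType) (d : nat) (f : 'rV[R]_d -> R) :
  continuous f -> measurable_fun [set: 'rV[R]_d] f.
Proof.
move=> cf; apply: (measurability _ (RGenOInfty.measurableE R)).
move=> _ [_ [a ->] <-]; rewrite setTI; apply: sub_sigma_algebra.
by move/continuousP : cf; apply; exact: interval_open.
Qed.

Lemma enorm_continuous (R : realType) (d : nat) :
  continuous (@enorm R d).
Proof.
apply: (@enorm_lipschitz_continuous _ _ _ 1) => x y.
by rewrite mul1r lerBlDr -{1}(subrK y x) enormD.
Qed.

Lemma enorm_shift_continuous (R : realType) (d : nat) (c : 'rV[R]_d) :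
  continuous (fun x => enorm (x - c)).
Proof.
apply: (@enorm_lipschitz_continuous _ _ _ 1) => x y.
rewrite mul1r lerBlDr (_ : x - c = x - y + (y - c)) ?enormD//.
by rewrite addrA subrK.
Qed.

Lemma open_rV_measurable (R : realType) (d : nat) (A : set 'rV[R]_d) :
  open A -> measurable A.
Proof. exact: sub_sigma_algebra. Qed.

Lemma eball_measurable (R : realType) (d : nat) (c : 'rV[R]_d) (r : R) :
  measurable (eball c r).
Proof.
apply: open_rV_measurable.
rewrite (_ : eball c r = (fun x => enorm (x - c)) @^-1` [set t | t < r])//.
by move/continuousP : (@enorm_shift_continuous _ _ c); apply; exact: open_lt.
Qed.

Lemma compact_rV_measurable (R : realType) (d : nat) (A : set 'rV[R]_d) :
  compact A -> measurable A.
Proof.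
move=> cA; rewrite -(setCK A); apply: measurableC; apply: open_rV_measurable.
by apply: closed_openC; apply: compact_closed => //; exact: norm_hausdorff.
Qed.

(** * Mean second differences with respect to a non-concentrated measure *)

Lemma exists_nat_between (R : realType) (r D : R) : 0 < r -> r <= D ->
  exists j : nat, (0 < j)%N /\ 4 * D <= r * j%:R /\ r * j%:R <= 5 * D.
Proof.
move=> r0 rD; exists (Num.truncn (4 * D / r)).+1; split => //.
have D0 : 0 <= D by lra.
have h0 : 0 <= 4 * D / r by apply: divr_ge0; lra.
have /andP[h2 h1] := truncn_itv h0.
rewrite ltr_pdivrMr// in h1; rewrite ler_pdivlMr// in h2.
split; first by rewrite [leRHS]mulrC ltW.
set t := Num.truncn _ in h1 h2 *.
by have -> : t.+1%:R = t%:R + 1 :> R by [rewrite natr1]; lra.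
Qed.

(** A cylinder is a union of lattice lines, on each of which the second differences
    telescope. *)
Lemma sum_second_diff_cylinder (R : realType) (d : nat) (f : 'rV[R]_d -> R)
    (hf : forall c, exists p, subgradient f c p) (B : R) (i : 'I_d)
    (x0 : 'rV[R]_d) (e T : R) (m P Q : nat) :
  (forall x y L, 0 <= L -> f (x + L *: delta_mx 0 i) - f x
     - (f (y + L *: delta_mx 0 i) - f y) <= L * B) ->
  0 <= e ->
  (\sum_(z : {ffun 'I_d -> 'I_P} | enorm (erase i (grid_offset e Q z)) < T)
    second_diff f (x0 + grid_offset e Q z) ((m%:R * e) *: delta_mx 0 i)) * P%:R
  <= #|[pred z : {ffun 'I_d -> 'I_P} |
        enorm (erase i (grid_offset e Q z)) < T]|%:R * (m%:R * (m%:R * e * B)).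
Proof.
move=> hB e0; rewrite mulr_natr.
pose F (z : {ffun 'I_d -> 'I_P}) :=
  second_diff f (x0 + grid_offset e Q z) ((m%:R * e) *: delta_mx 0 i).
rewrite -(@sum_columns _ _ _ i _ F) => [|z k]; last first.
  congr (_ < _); congr enorm; apply/rowP => l; rewrite !mxE.
  by case: eqP => // /eqP li; rewrite ffunE (negbTE li).
rewrite mulr_natl -sumr_const; apply: ler_sum => z _.
pose a := x0 + grid_offset e Q z - ((z i)%:R * e) *: delta_mx 0 i.
rewrite (eq_bigr (fun k : 'I_P =>
    second_diff f (a + (k%:R * e) *: delta_mx 0 i) ((m%:R * e) *: delta_mx 0 i))).
  exact: sum_second_diff_column.
move=> k _; rewrite /F; congr (second_diff f _ _).
apply/rowP => l; rewrite !mxE ffunE eqxx /= !mulr_natr !mulrb.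
by case: eqP => [->|_]; lra.
Qed.

(** H averages, over the lattice points within r of x, the coordinate second
    differences with step 2dr. Its integral is a finite sum over lattice points
    of second differences times the mass of a ball of radius r, which the growth
    hypothesis bounds; the lattice points that contribute lie in the cylinders
    around all coordinate axes. *)
Lemma second_diff_integral_bound (R : realType) (n : nat)
    (rho : probability 'rV[R]_n.+1 R) (M theta : R) (x0 : 'rV[R]_n.+1) (D r : R)
    (f : 'rV[R]_n.+1 -> R) (B : R) :
  (forall (x : 'rV[R]_n.+1) (eta : R), 0 < eta ->
     (rho (eball x eta) <= (M * eta `^ (n.+1%:R - 1 + theta))%:E)%E) ->
  (forall c, exists p, subgradient f c p) ->
  (forall i x y L, 0 <= L -> f (x + L *: delta_mx 0 i) - f x
     - (f (y + L *: delta_mx 0 i) - f y) <= L * B) ->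
  0 < M -> 0 < r -> r <= D ->
  exists H : 'rV[R]_n.+1 -> R, [/\ measurable_fun setT H, forall x, 0 <= H x,
    forall x v, enorm (x - x0) <= D -> enorm v <= r ->
      second_diff f x v <= r * H x &
    (\int[rho]_x (H x)%:E
      <= (8 * n.+1%:R ^+ 2 * 5 ^+ n * M * B * D ^+ n * r `^ theta)%:E)%E].
Proof.
move=> hball hf hB M0 r0 rD.
have D0 : 0 < D by exact: lt_le_trans rD.
have [j [j0' [Dj jD]]] := exists_nat_between r0 rD.
have j0 : 0 < j%:R :> R by rewrite ltr0n.
set d := n.+1 in x0 f hball hf hB *.
have d0 : 0 < d%:R :> R by rewrite ltr0n.
have B0 : 0 <= B.
  by have := hB ord0 0 0 1 ler01; rewrite subrr mul1r.
(* The spacing e = r / 8d makes the step 2dr equal to m e and the box of side P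
   long enough to contain the ball of radius 2D around its centre Q. *)
pose P := (8 * d * j)%N; pose Q := (4 * d * j)%N; pose m := (16 * d * d)%N.
pose e : R := r / (8 * d%:R).
have ed : e * (8 * d%:R) = r by rewrite /e mulfVK// gt_eqF// mulr_gt0.
have e0 : 0 < e by rewrite divr_gt0// mulr_gt0.
have P0 : (0 < P)%N by rewrite !muln_gt0.
have Lm : 2 * d%:R * r = m%:R * e by rewrite -ed /m !natrM; lra.
pose c (z : {ffun 'I_d -> 'I_P}) := x0 + grid_offset e Q z.
pose sd i z := second_diff f (c z) ((2 * d%:R * r) *: delta_mx 0 i).
have sd0 i z : 0 <= sd i z.
  by have [p hp] := hf (c z); exact: second_diff_ge0 hp.
pose cyl i := [pred z : {ffun 'I_d -> 'I_P} |
  enorm (erase i (grid_offset e Q z)) < 2 * D].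
(* By card_cylinder_le, every ball of radius r around a point near x0 contains at
   least Wm / j ^ d lattice points; this normalises the average in H. *)
pose Wm := \max_(i < d) #|cyl i|.
have leW i : (#|cyl i| <= Wm)%N by exact: (@leq_bigmax _ (fun i => #|cyl i|)).
have Wm0 : (0 < Wm)%N.
  apply: (@leq_trans #|cyl ord0|); last exact: leW.
  apply/card_gt0P.
  have QP : (Q < P)%N by rewrite /Q /P !ltn_pmul2r.
  exists [ffun=> Ordinal QP]; rewrite inE /=.
  rewrite (_ : erase _ _ = 0) ?enorm0 ?mulr_gt0//.
  by apply/rowP => l; rewrite !mxE ffunE /= subrr mulr0 if_same.
have Wm0' : 0 < Wm%:R :> R by rewrite ltr0n.
pose good (z : {ffun 'I_d -> 'I_P}) := enorm (grid_offset e Q z : 'rV[R]_d) < 2 * D.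
pose k0 := j%:R ^+ d / Wm%:R * (2 / d%:R / r).
have k00 : 0 <= k0 by rewrite ltW// /k0 !(mulr_gt0, invr_gt0, exprn_gt0)//.
pose S z := \sum_(i < d) sd i z.
have S0 z : 0 <= S z by apply: sumr_ge0.
pose H (x : 'rV[R]_d) : R := \sum_(z | good z) (k0 * S z) * \1_(eball (c z) r) x.
have kS0 z : 0 <= k0 * S z by exact: mulr_ge0.
have term0 z x : 0 <= (k0 * S z) * \1_(eball (c z) r) x :> R.
  by rewrite indicE mulr_ge0.
have H0 x : 0 <= H x by apply: sumr_ge0 => z _.
have mterm z : measurable_fun setT
    (fun x => (k0 * S z) * \1_(eball (c z) r) x).
  apply: measurable_funM => //.
  by apply: measurable_indic; exact: eball_measurable.
exists H; split => //.
- rewrite /H; under eq_fun do rewrite -big_filter.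
  by apply: measurable_sum => z; exact: mterm.
- move=> x v xD vr.
  have bound z : enorm (c z - x) < r -> good z /\ second_diff f x v <= 2 / d%:R * S z.
    move=> zx; split.
      rewrite /good (_ : grid_offset e Q z = c z - x + (x - x0)); last first.
        by rewrite addrA subrK /c addrC addKr.
      by apply: le_lt_trans (enormD _ _) _; lra.
    by apply: second_diff_le_axes => //; rewrite enormB ltW.
  pose Bx := [pred z | enorm (c z - x) < r].
  have cnt : Wm%:R <= #|Bx|%:R * j%:R ^+ d :> R.
    rewrite -natrX -natrM ler_nat; apply/bigmax_leqP => i _.
    exact: (@card_cylinder_le _ d _ _ _ D r e j P Q i).
  have : \sum_(z | Bx z) (k0 * S z) <= H x.
    rewrite /H big_mkcond [leRHS]big_mkcond /=; apply: ler_sum => z _.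
    case: ifPn => [zx|_]; last by case: ifPn => // _; exact: term0.
    have [-> _] := bound z zx; rewrite indicE mem_set ?mulr1//=.
    by rewrite /eball /= enormB.
  move=> HB; rewrite -ler_pdivrMl//; apply: le_trans HB.
  apply: (@le_trans _ _ (\sum_(z | Bx z) j%:R ^+ d / Wm%:R * (r^-1 * second_diff f x v))).
    rewrite sumr_const -[leRHS]mulr_natl [leRHS]mulrA ler_peMl//.
      rewrite mulr_ge0 ?invr_ge0 ?(ltW r0)//.
      by have [p hp] := hf x; exact: second_diff_ge0 hp.
    by rewrite mulrA ler_pdivlMr// mul1r.
  apply: ler_sum => z zx; have [_ sz] := bound z zx.
  rewrite /k0 -[leRHS]mulrA; apply: ler_wpM2l.
    by rewrite divr_ge0 ?exprn_ge0// ltW.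
  by rewrite mulrC [leRHS]mulrAC ler_pM2r ?invr_gt0.
- pose w : R := r `^ (d%:R - 1 + theta).
  have w0 : 0 <= w by exact: powR_ge0.
  rewrite (_ : (fun x => (H x)%:E) = (fun x =>
     \sum_(z | good z) ((k0 * S z) * \1_(eball (c z) r) x)%:E)%E); last first.
    by apply/funext => x; rewrite sumEFin.
  under eq_integral do rewrite -big_filter.
  rewrite ge0_integral_sum//; last 2 first.
  + by move=> z; apply/measurable_EFinP; exact: mterm.
  + by move=> z x _; rewrite lee_fin term0.
  rewrite big_filter.
  apply: (@le_trans _ _ (\sum_(z | good z) ((k0 * S z) * (M * w))%:E)%E).
    apply: lee_sum => z _; under eq_integral do rewrite EFinM.
    rewrite ge0_integralZl//; last 2 first.
    + apply/measurable_EFinP; apply: measurable_indic; exact: eball_measurable.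
    + by rewrite lee_fin kS0.
    rewrite integral_indic// ?setIT; last exact: eball_measurable.
    rewrite [leRHS]EFinM; apply: lee_wpmul2l; [by rewrite lee_fin kS0|exact: hball].
  rewrite sumEFin lee_fin -mulr_suml -mulr_sumr.
  have sumS : (\sum_(z | good z) S z) * P%:R
      <= d%:R * (Wm%:R * (m%:R * (2 * d%:R * r * B))).
    rewrite /S exchange_big /= mulr_suml.
    rewrite [leRHS](_ : _ = \sum_(i < d) (Wm%:R * (m%:R * (2 * d%:R * r * B)))); last first.
      by rewrite sumr_const card_ord mulr_natl.
    apply: ler_sum => i _.
    apply: (@le_trans _ _ ((\sum_(z | cyl i z) sd i z) * P%:R)).
      rewrite ler_wpM2r// big_mkcond [leRHS]big_mkcond; apply: ler_sum => z _.
      case: ifPn => [gz|_]; last by case: ifPn.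
      by rewrite ifT// /cyl /=; apply: le_lt_trans (enorm_erase_le _ _) gz.
    rewrite /sd Lm; apply: le_trans (sum_second_diff_cylinder hf x0 _ _ _ _ (hB i) (ltW e0)) _.
    apply: ler_wpM2r; last by rewrite ler_nat leW.
    by rewrite -Lm !mulr_ge0// ltW.
  have jr : j%:R ^+ n <= (5 * D / r) ^+ n.
    by rewrite lerXn2r ?nnegrE ?divr_ge0 ?mulr_ge0 ?ler_pdivlMr ?(ltW D0) ?(ltW r0) 1?mulrC.
  have wE : w = r ^+ n * r `^ theta.
    rewrite /w /d -natr1 addrK powRD; last by rewrite (gt_eqF r0) implybT.
    by rewrite powR_mulrn// ltW.
  have PR : P%:R = 8 * d%:R * j%:R :> R by rewrite /P !natrM.
  have mR : m%:R = 16 * d%:R * d%:R :> R by rewrite /m !natrM.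
  have step : k0 * (\sum_(z | good z) S z) <= 8 * d%:R ^+ 2 * j%:R ^+ n * B.
    rewrite -(ler_pM2r (_ : 0 < P%:R)) ?ltr0n// -[leLHS]mulrA.
    apply: le_trans (ler_wpM2l k00 sumS) _.
    rewrite PR mR /k0 /d exprS le_eqVlt; apply/orP; left; apply/eqP.
    by rewrite -/d; field; rewrite !gt_eqF.
  apply: le_trans (ler_wpM2r (mulr_ge0 (ltW M0) w0) step) _.
  have rt : 0 <= r `^ theta by exact: powR_ge0.
  rewrite wE; move: jr; rewrite !exprMn exprVn ler_pdivlMr ?exprn_gt0// => jr.
  rewrite (_ : _ * _ * (M * _) =
    (8 * d%:R ^+ 2 * B * M * r `^ theta) * (j%:R ^+ n * r ^+ n)); last by ring.
  apply: le_trans (ler_wpM2l _ jr) _; first by rewrite !mulr_ge0// ?sqr_ge0 ?(ltW M0).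
  by rewrite le_eqVlt; apply/orP; left; apply/eqP; ring.
Qed.

(** * Volumes of unit balls *)

(** Lebesgue measure is the only measure with its values on half-open intervals, and
    the image of Lebesgue measure under t |-> t / s, divided by s, has these
    values. *)
Lemma ge0_integral_scale (R : realType) (s : R) (f : R -> \bar R) : 0 < s ->
  measurable_fun [set: measurableTypeR R] f -> (forall t, 0 <= f t)%E ->
  (\int[@lebesgue_measure R]_t f (t / s)%R = s%:E * \int[lebesgue_measure]_t f t)%E.
Proof.
move=> s0 mf f0.
pose phi : measurableTypeR R -> measurableTypeR R := fun t => t / s.
have mphi : measurable_fun [set: measurableTypeR R] phi.
  exact: mulrr_measurable.
have sV0 : 0 <= s^-1 by rewrite invr_ge0 ltW.
(* An image measure is a measure only relative to a proof of measurability, which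
   is packed here. *)
have [pm pmE] : exists pm : {measure set (measurableTypeR R) -> \bar R},
    (pm : set (measurableTypeR R) -> \bar R) =
    pushforward (@lebesgue_measure R) phi.
  by unshelve eexists (pushforward (@lebesgue_measure R) phi).
pose m := mscale (NngNum sV0) pm.
have mA A : (m A = s^-1%:E * lebesgue_measure (phi @^-1` A))%E.
  exact: (congr1 (fun F : set (measurableTypeR R) -> \bar R => s^-1%:E * F A)%E pmE).
have mE (A : set (measurableTypeR R)) : measurable A -> lebesgue_measure A = m A.
  apply: lebesgue_measure_unique => _ [[a b] _ <-].
  apply: etrans (esym (mA _)).
  rewrite (_ : phi @^-1` _ = `]a * s, b * s]%classic).
    rewrite !lebesgue_measure_itv /= !lte_fin ltr_pM2r//.
    case: ifP => _; last by rewrite mule0.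
    by rewrite -!EFinD -EFinM; congr EFin; field; rewrite gt_eqF.
  by apply/seteqP; split => t /=; rewrite !in_itv /= /phi ltr_pdivlMr// ler_pdivrMr.
have -> : (\int[@lebesgue_measure R]_t f (t / s)%R = \int[pm]_t f t)%E.
  by rewrite pmE ge0_integral_pushforward// preimage_setT.
have -> : (\int[@lebesgue_measure R]_t f t = \int[m]_t f t)%E.
  by apply: eq_measure_integral => A ? _; exact: mE.
by rewrite ge0_integral_mscale//= muleA -EFinM divff ?mul1e// gt_eqF.
Qed.

Lemma dotp_row_mx (R : realType) (k l : nat) (x x' : 'rV[R]_k) (y y' : 'rV[R]_l) :
  dotp (row_mx x y) (row_mx x' y') = dotp x x' + dotp y y'.
Proof.
rewrite /dotp big_split_ord; congr (_ + _); apply: eq_bigr => i _.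
  by rewrite !row_mxEl.
by rewrite !row_mxEr.
Qed.

Lemma lebesgue_rV_set0 (R : realType) (k : nat) :
  lebesgue_rV (set0 : set 'rV[R]_k) = 0%E.
Proof.
elim: k => [|k IH]; first by rewrite /= dirac0.
rewrite /= /product_measure1 integral0_eq// => t _ /=.
by rewrite (_ : [set p | _] = set0) ?xsection0 ?IH.
Qed.

(** The relative volume of the slice at height t of the unit ball in dimension
    k + 1. The indicator matters for k = 0, where the power is 1 even outside the
    interval. *)
Definition slice_volume (R : realType) (k : nat) (t : R) : R :=
  \1_(`]-1, 1[%classic : set R) t * Num.sqrt (1 - t ^+ 2) ^+ k.

Lemma slice_volume_ge0 (R : realType) (k : nat) (t : R) : 0 <= slice_volume k t.
Proof. by rewrite mulr_ge0 ?exprn_ge0// indicE. Qed.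

Lemma measurable_slice_volume (R : realType) (k : nat) :
  measurable_fun [set: measurableTypeR R] (@slice_volume R k).
Proof.
apply: measurable_funM; first by apply: measurable_indic; exact: measurable_itv.
apply: measurable_funX; apply: continuous_measurable_fun => t.
apply: (@continuous_comp _ _ _ (fun t : R => 1 - t ^+ 2) Num.sqrt).
  by apply: cvgB; [exact: cvg_cst|exact: exprn_continuous].
exact: sqrt_continuous.
Qed.

Lemma slice_eball (R : realType) (k : nat) (s t : R) : 0 < s ->
  xsection [set p | eball (0 : 'rV[R]_(1 + k)) s (row_mx p.1%:M p.2)] t =
  if `|t| < s then eball (0 : 'rV[R]_k) (s * Num.sqrt (1 - (t / s) ^+ 2))
  else set0.
Proof.
move=> s0; rewrite /xsection.
have E (y : 'rV[R]_k) : (enorm (row_mx (t%:M : 'rV[R]_1) y) < s) =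
    (t ^+ 2 + enorm y ^+ 2 < s ^+ 2).
  rewrite -(@ltr_pXn2r _ 2)// ?nnegrE ?enorm_ge0 ?(ltW s0)//.
  by rewrite !sqr_enorm dotp_row_mx {1}/dotp big_ord1 !mxE eqxx mulr1n.
have tE : s ^+ 2 * (1 - (t / s) ^+ 2) = s ^+ 2 - t ^+ 2 by field; rewrite gt_eqF.
have tp : `|t| < s -> 0 <= 1 - (t / s) ^+ 2.
  move=> ts; rewrite subr_ge0 -(real_normK (num_real (t / s))) exprn_ile1//.
  by rewrite normrM normfV (gtr0_norm s0) ler_pdivrMr// mul1r ltW.
apply/seteqP; split => y /=; rewrite in_setE /eball /= subr0 E; last first.
  case: ifPn => //= ts; rewrite subr0 => ys.
  rewrite -ltrBrDl -tE -[X in _ * X](sqr_sqrtr (tp ts)).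
  by rewrite -exprMn ltr_pXn2r// ?nnegrE ?enorm_ge0 ?mulr_ge0// ltW.
move=> h; have y2 := sqr_ge0 (enorm y).
have ts : `|t| < s.
  rewrite -(@ltr_pXn2r _ 2)// ?nnegrE ?(ltW s0)// real_normK ?num_real//; lra.
rewrite ts /= subr0 -(@ltr_pXn2r _ 2)// ?nnegrE ?enorm_ge0 ?mulr_ge0 ?(ltW s0)//.
by rewrite exprMn (sqr_sqrtr (tp ts)) tE; lra.
Qed.

Lemma integral_indic_itv (R : realType) (i : interval R) :
  (\int[@lebesgue_measure R]_t (\1_([set` i] : set R) t)%:E =
   if i.1 < i.2 then (i.2 : \bar R) - i.1 else 0)%E.
Proof.
transitivity (lebesgue_measure ([set` i] : set R)); last exact: lebesgue_measure_itv.
by rewrite integral_indic ?setIT//; exact: measurable_itv.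
Qed.

(** The lower bound comes from the heights |t| <= 1/2, where the radius of the slice
    is at least sqrt(3/4) >= 5/6. *)
Lemma slice_volume_integral (R : realType) (k : nat) :
  exists2 I : R, (5 / 6) ^+ k <= I &
   (\int[@lebesgue_measure R]_t (slice_volume k t)%:E)%E = I%:E.
Proof.
have h1 : (\int[@lebesgue_measure R]_t (slice_volume k t)%:E <= 2%:E)%E.
  apply: (@le_trans _ _ (\int[@lebesgue_measure R]_t
      (\1_(`]-1, 1[%classic : set R) t)%:E)%E).
    apply: ge0_le_integral => //.
    - by move=> t _; rewrite lee_fin slice_volume_ge0.
    - by apply/measurable_EFinP; exact: measurable_slice_volume.
    - by apply/measurable_EFinP; apply: measurable_indic; exact: measurable_itv.
    move=> t _; rewrite lee_fin /slice_volume ler_piMr ?indicE//.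
    rewrite exprn_ile1// -[leRHS]sqrtr1 ler_wsqrtr// lerBlDr lerDl sqr_ge0//.
  rewrite integral_indic_itv /= lte_fin ifT ?gtrN//.
  by rewrite -EFinB lee_fin; lra.
have h2 : (((5 / 6) ^+ k)%:E <= \int[@lebesgue_measure R]_t (slice_volume k t)%:E)%E.
  apply: (@le_trans _ _ (\int[@lebesgue_measure R]_t
      (((5 / 6) ^+ k)%:E * (\1_(`[- 2^-1, 2^-1]%classic : set R) t)%:E))%E).
    rewrite ge0_integralZl//; last first.
      by apply/measurable_EFinP; apply: measurable_indic; exact: measurable_itv.
    rewrite integral_indic_itv /= lte_fin ifT; last by lra.
    by rewrite -EFinB -EFinM lee_fin (_ : 2^-1 - - 2^-1 = 1 :> R) ?mulr1//; lra.
  apply: ge0_le_integral => //.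
  - under eq_fun do rewrite -EFinM.
    by apply/measurable_EFinP; apply: measurable_funM => //.
  - by apply/measurable_EFinP; exact: measurable_slice_volume.
  move=> t _; rewrite -EFinM lee_fin indicE; case: (boolP (t \in _)); last first.
    by rewrite mulr0 slice_volume_ge0.
  rewrite in_setE /= in_itv /= => /andP[t1 t2].
  rewrite mulr1 /slice_volume indicE mem_set ?mul1r; last first.
    by rewrite /= in_itv /=; apply/andP; split; lra.
  rewrite lerXn2r ?nnegrE ?divr_ge0//.
  rewrite -[leLHS]ger0_norm ?divr_ge0// -sqrtr_sqr ler_wsqrtr//.
  by rewrite exprMn exprVn; nra.
move: h1 h2; case: (integral _ _ _) => [I| |]//=; rewrite ?lee_fin.
by move=> _ h2; exists I.
Qed.

(** Slicing and the homogeneity of the volume in dimension k give the homogeneity in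
    dimension k + 1, the integral of the slice volumes being the ratio of the two
    unit ball volumes. *)
Lemma lebesgue_rV_eballS (R : realType) (k : nat) (b I : R) :
  (forall s, 0 < s -> lebesgue_rV (eball (0 : 'rV[R]_k) s) = (s ^+ k * b)%:E) ->
  0 <= b ->
  (\int[@lebesgue_measure R]_t (slice_volume k t)%:E)%E = I%:E ->
  forall s, 0 < s -> lebesgue_rV (eball (0 : 'rV[R]_k.+1) s) = (s ^+ k.+1 * (b * I))%:E.
Proof.
move=> hb b0 hI s s0; rewrite /= /product_measure1.
transitivity (\int[@lebesgue_measure R]_t
   ((b * s ^+ k)%:E * (slice_volume k (t / s))%:E))%E.
  apply: eq_integral => t _ /=; rewrite slice_eball//.
  have ts : (t / s \in (`]-1, 1[%classic : set R)) = (`|t| < s).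
    by rewrite mem_setE in_itv /= ltr_pdivlMr// ltr_pdivrMr// mulN1r mul1r ltr_norml.
  rewrite /slice_volume indicE ts; case: ifPn => [h|_]; last first.
    by rewrite mul0r mule0 lebesgue_rV_set0.
  rewrite hb ?mul1r -?EFinM; first by congr EFin; rewrite exprMn; ring.
  rewrite mulr_gt0// sqrtr_gt0 subr_gt0 -(real_normK (num_real (t / s))).
  by rewrite expr_lt1// normrM normfV (gtr0_norm s0) ltr_pdivrMr// mul1r.
rewrite ge0_integralZl//; last 3 first.
- apply/measurable_EFinP.
  apply: (measurableT_comp (measurable_slice_volume k)); exact: mulrr_measurable.
- by move=> t _; rewrite lee_fin slice_volume_ge0.
- by rewrite lee_fin mulr_ge0// exprn_ge0// ltW.
rewrite (@ge0_integral_scale R s (fun t => (slice_volume k t)%:E))//.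
- by rewrite hI -!EFinM; congr EFin; rewrite exprS; ring.
- by apply/measurable_EFinP; exact: measurable_slice_volume.
- by move=> t; rewrite lee_fin slice_volume_ge0.
Qed.

Lemma lebesgue_rV_eball (R : realType) (k : nat) :
  0 < beta R k /\ forall s, 0 < s -> lebesgue_rV (eball (0 : 'rV[R]_k) s) = (s ^+ k * beta R k)%:E.
Proof.
suff [b [b0 hb]] : exists b, 0 < b /\
    forall s, 0 < s -> lebesgue_rV (eball (0 : 'rV[R]_k) s) = (s ^+ k * b)%:E.
  suff -> : beta R k = b by [].
  by rewrite /beta hb// expr1n mul1r.
elim: k => [|k [b [b0 hb]]].
  exists 1; split => // s s0; rewrite /= diracE mem_set ?mulr1//.
  by rewrite /eball /= subrr enorm0.
have [I I0 hI] := slice_volume_integral R k.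
exists (b * I); split; last exact: lebesgue_rV_eballS (ltW b0) hI.
by rewrite mulr_gt0// (lt_le_trans _ I0)// exprn_gt0// divr_gt0.
Qed.

Lemma beta_ratio_ge (R : realType) (k : nat) :
  (5 / 6) ^+ k <= beta R k.+1 / beta R k.
Proof.
have [b0 hb] := lebesgue_rV_eball R k.
have [I I0 hI] := slice_volume_integral R k.
rewrite {1}/beta (lebesgue_rV_eballS hb (ltW b0) hI)// expr1n mul1r /=.
by rewrite mulrAC divff ?mul1r// gt_eqF.
Qed.

(** * Dual pairs and their subgradients *)

(** One half of a dual pair; both halves have this form, by the symmetry of the
    scalar product. *)
Definition conjugate_on (R : realType) (d : nat) (Y : set 'rV[R]_d)
    (f g : 'rV[R]_d -> R) :=
  forall x, (f x)%:E = ereal_sup [set (dotp x y - g y)%:E | y in Y].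

Lemma dual_pair_conjugate (R : realType) (d : nat) (X Y : set 'rV[R]_d)
    (phi psi : 'rV[R]_d -> R) :
  dual_pair X Y phi psi -> conjugate_on Y phi psi /\ conjugate_on X psi phi.
Proof.
move=> [h1 h2]; split => // y; rewrite h2; congr ereal_sup.
by apply/seteqP; split => _ [x Xx <-]; exists x; rewrite // dotpC.
Qed.

Lemma conjugate_ge (R : realType) (d : nat) (Y : set 'rV[R]_d)
    (f g : 'rV[R]_d -> R) (x y : 'rV[R]_d) :
  conjugate_on Y f g -> Y y -> dotp x y <= f x + g y.
Proof.
move=> hf Yy; rewrite -lerBlDr -lee_fin hf.
by apply: ereal_sup_ubound; exists y.
Qed.

Lemma conjugate_nonempty (R : realType) (d : nat) (Y : set 'rV[R]_d)
    (f g : 'rV[R]_d -> R) :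
  conjugate_on Y f g -> Y !=set0.
Proof.
move=> hf; apply/set0P/negP => /eqP Y0; have := hf 0.
by rewrite Y0 image_set0 ereal_sup0.
Qed.

Lemma compact_enorm_bounded (R : realType) (d : nat) (Y : set 'rV[R]_d) :
  compact Y -> exists2 K, 0 <= K & forall y, Y y -> enorm y <= K.
Proof.
move=> cY; have [Y0|/nonemptyPn Y0] := pselect (Y !=set0); last first.
  by exists 0 => // y; rewrite Y0.
have [|c _ hc] := EVT_max_rV Y0 cY (f := @enorm R d).
  by apply: continuous_subspaceT; exact: enorm_continuous.
by exists (enorm c) => [|y Yy]; [exact: enorm_ge0|apply: hc; rewrite inE].
Qed.

Lemma le_ediam (R : realType) (d : nat) (Y : set 'rV[R]_d) (x y : 'rV[R]_d) :
  compact Y -> Y x -> Y y -> enorm (x - y) <= ediam Y.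
Proof.
move=> cY Yx Yy; have [K K0 hK] := compact_enorm_bounded cY.
apply: sup_upper_bound; last by exists x => //; exists y.
split; first by exists (enorm (x - y)); exists x => //; exists y.
exists (K + K) => _ [z Yz [w Yw <-]].
by apply: le_trans (enormB_le _ _) _; apply: lerD; exact: hK.
Qed.

Lemma conjugate_continuous (R : realType) (d : nat) (Y : set 'rV[R]_d)
    (f g : 'rV[R]_d -> R) :
  compact Y -> conjugate_on Y f g -> continuous f.
Proof.
move=> cY hf; have [K K0 hK] := compact_enorm_bounded cY.
apply: (@enorm_lipschitz_continuous _ _ _ K) => x x'.
rewrite lerBlDr -lee_fin hf; apply: ge_ereal_sup => _ [y Yy <-]; rewrite lee_fin.
have := conjugate_ge x' hf Yy; have := cauchy_schwarz (x - x') y.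
have := ler_wpM2l (enorm_ge0 (x - x')) (hK y Yy).
rewrite dotpBl; lra.
Qed.

Lemma dotp_continuousr (R : realType) (d : nat) (x : 'rV[R]_d) :
  continuous (dotp x).
Proof.
apply: (@enorm_lipschitz_continuous _ _ _ (enorm x)) => y z.
by rewrite -dotpBr cauchy_schwarz.
Qed.

(** The supremum is attained at some p in the compact set Y, and a maximiser is a
    subgradient. *)
Lemma conjugate_subgradient (R : realType) (d : nat) (Y : set 'rV[R]_d)
    (f g : 'rV[R]_d -> R) :
  compact Y -> continuous g -> conjugate_on Y f g ->
  forall x, exists2 p, Y p & subgradient f x p.
Proof.
move=> cY cg hf x; have Y0 := conjugate_nonempty hf.
have [|p Yp hp] := EVT_max_rV Y0 cY (f := fun y => dotp x y - g y).
  apply: continuous_subspaceT => y.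
  by apply: continuousB; [exact: dotp_continuousr|exact: cg].
rewrite inE in Yp; exists p => // z.
have fx : f x <= dotp x p - g p.
  rewrite -lee_fin hf; apply: ge_ereal_sup => _ [y Yy <-]; rewrite lee_fin.
  by apply: hp; rewrite inE.
by have := conjugate_ge z hf Yp; rewrite dotpBl; lra.
Qed.

Lemma dual_pair_continuous (R : realType) (d : nat) (X Y : set 'rV[R]_d)
    (phi psi : 'rV[R]_d -> R) :
  compact X -> compact Y -> dual_pair X Y phi psi ->
  continuous phi /\ continuous psi.
Proof.
move=> cX cY /dual_pair_conjugate[h1 h2].
by split; [exact: (conjugate_continuous cY h1)|exact: (conjugate_continuous cX h2)].
Qed.

Lemma dual_pair_subgradient (R : realType) (d : nat) (X Y : set 'rV[R]_d)
    (phi psi : 'rV[R]_d -> R) :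
  compact X -> compact Y -> dual_pair X Y phi psi ->
  (forall x, exists2 p, Y p & subgradient phi x p) /\
  (forall y, exists2 p, X p & subgradient psi y p).
Proof.
move=> cX cY h; have [c1 c2] := dual_pair_continuous cX cY h.
have [h1 h2] := dual_pair_conjugate h.
by split; [exact: (conjugate_subgradient cY c2 h1)|exact: (conjugate_subgradient cX c1 h2)].
Qed.

(** This single estimate yields the Lipschitz bound for f - g (take x = y) and the
    bound on the oscillation of the slopes of f (take g = f). *)
Lemma subgradient_slope (R : realType) (d : nat) (Y : set 'rV[R]_d)
    (f g : 'rV[R]_d -> R) (x y u : 'rV[R]_d) :
  compact Y ->
  (forall x, exists2 p, Y p & subgradient f x p) ->
  (forall x, exists2 p, Y p & subgradient g x p) ->
  f (x + u) - f x - (g (y + u) - g y) <= enorm u * ediam Y.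
Proof.
move=> cY hf hg; have [p Yp hp] := hf (x + u); have [q Yq hq] := hg y.
have h1 := hp x; rewrite opprD addNKr dotpNl in h1.
have h2 := hq (y + u); rewrite addrAC subrr add0r in h2.
have h3 := cauchy_schwarz u (p - q); rewrite dotpBr in h3.
have := ler_wpM2l (enorm_ge0 u) (le_ediam cY Yp Yq); lra.
Qed.

Lemma conjugate_convex (R : realType) (d : nat) (Y : set 'rV[R]_d)
    (f g : 'rV[R]_d -> R) :
  conjugate_on Y f g -> convex_function setT f.
Proof.
move=> hf t x y _ _.
have -> : conv t (f x : R^o) (f y : R^o) = t%:inum * f x + (1 - t%:inum) * f y by [].
have -> : conv t x y = t%:inum *: (x : 'rV[R]_d) + (1 - t%:inum) *: (y : 'rV[R]_d) by [].
rewrite -lee_fin hf; apply: ge_ereal_sup => _ [z Yz <-]; rewrite lee_fin.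
rewrite dotpDl !dotpZl.
have t0 : 0 <= t%:inum :> R by [].
have t1 : 0 <= 1 - t%:inum :> R by rewrite subr_ge0.
have h1 := ler_wpM2l t0 (conjugate_ge x hf Yz).
have h2 := ler_wpM2l t1 (conjugate_ge y hf Yz).
lra.
Qed.

(** The conjugate over the whole space, as used in the dual functional, is compared
    with the potential that is paired over a compact set only. *)
Lemma fenchel_conjugate_le (R : realType) (d : nat) (Y : set 'rV[R]_d)
    (f g : 'rV[R]_d -> R) (y : 'rV[R]_d) :
  conjugate_on Y f g -> Y y -> (fenchel_conjugate f y <= (g y)%:E)%E.
Proof.
move=> hf Yy; apply: ge_ereal_sup => _ [x _ <-]; rewrite lee_fin.
by have := conjugate_ge x hf Yy; lra.
Qed.

Lemma fenchel_conjugate_ge (R : realType) (d : nat) (X : set 'rV[R]_d)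
    (f g : 'rV[R]_d -> R) (y : 'rV[R]_d) :
  conjugate_on X g f -> ((g y)%:E <= fenchel_conjugate f y)%E.
Proof.
move=> hg; rewrite hg; apply: ge_ereal_sup => _ [x Xx <-].
by apply: ereal_sup_ubound; exists x; rewrite // dotpC.
Qed.

(** A supremum of continuous functions is lower semicontinuous. *)
Lemma measurable_fenchel_conjugate (R : realType) (d : nat) (f : 'rV[R]_d -> R) :
  measurable_fun [set: 'rV[R]_d] (fenchel_conjugate f).
Proof.
apply: (measurability _ (ErealGenOInfty.measurableE R)).
move=> _ [_ [a ->] <-]; rewrite setTI; apply: open_rV_measurable.
rewrite (_ : _ @^-1` _ = \bigcup_x [set y | a < dotp x y - f x]).
  apply: bigcup_open => x _.
  rewrite (_ : [set _ | _] = (fun y => dotp x y - f x) @^-1` [set t | a < t])//.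
  apply: open_comp; last exact: open_gt.
  by move=> y _; apply: continuousB; [exact: dotp_continuousr|exact: cst_continuous].
apply/seteqP; split => y /=; rewrite in_itv /= andbT.
  by move=> /ereal_sup_gt[_ [x _ <-]]; rewrite lte_fin => h; exists x.
move=> [x _ h]; apply: (@lt_le_trans _ _ (dotp x y - f x)%:E).
  by rewrite lte_fin.
by apply: ereal_sup_ubound; exists x.
Qed.

(** Each y in Y splits the pairing of x as the mean of its pairings with x - v and
    x + v, which are bounded by f0 and f1 respectively. *)
Lemma conjugate_midpoint (R : realType) (d : nat) (Y : set 'rV[R]_d)
    (f0 f1 g0 g1 : 'rV[R]_d -> R) :
  conjugate_on Y f0 g0 -> conjugate_on Y f1 g1 ->
  exists2 h, conjugate_on Y h (fun y => (g0 y + g1 y) / 2) &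
    (forall x v, 2 * h x <= f0 (x - v) + f1 (x + v)).
Proof.
move=> h0 h1; have [y0 Yy0] := conjugate_nonempty h0.
pose S x := ereal_sup [set (dotp x y - (g0 y + g1 y) / 2)%:E | y in Y].
have ub x v : (S x <= ((f0 (x - v) + f1 (x + v)) / 2)%:E)%E.
  apply: ge_ereal_sup => _ [y Yy <-]; rewrite lee_fin.
  have := conjugate_ge (x - v) h0 Yy; have := conjugate_ge (x + v) h1 Yy.
  by rewrite dotpBl dotpDl; lra.
have Sfin x : S x \is a fin_num.
  rewrite fin_numElt (le_lt_trans (ub x 0)) ?ltry// andbT.
  apply: lt_le_trans (ltNyr (dotp x y0 - (g0 y0 + g1 y0) / 2)) _.
  by apply: ereal_sup_ubound; exists y0.
exists (fun x => fine (S x)) => [x|x v]; first by rewrite fineK.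
by have := ub x v; rewrite -[S x]fineK// lee_fin; lra.
Qed.

(** * The integrated gap between the potentials *)

Lemma integral_full_measure (dT : measure_display) (T : measurableType dT)
    (R : realType) (P : probability T R) (Y : set T) (f : T -> \bar R) :
  measurable Y -> P Y = 1%E -> measurable_fun setT f ->
  (\int[P]_x f x = \int[P]_(x in Y) f x)%E.
Proof.
move=> mY PY mf; rewrite [RHS]integral_mkcond.
apply: ae_eq_integral => //.
  by apply/(measurable_restrictT _ _).1 => //; exact: measurable_funTS.
exists (~` Y); split; first exact: measurableC.
- by have := probability_setC P mY; rewrite PY subee.
- by move=> x /=; apply: contra_not => Yx _; rewrite patchE mem_set.
Qed.

(** Meant for Fenchel conjugates, which can be infinite outside Y. *)
Lemma measurable_le_integral (dT : measure_display) (T : measurableType dT)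
    (R : realType) (P : {measure set T -> \bar R}) (D : set T)
    (f g : T -> \bar R) :
  measurable D -> measurable_fun D f -> measurable_fun D g ->
  (forall x, D x -> f x <= g x)%E ->
  (\int[P]_(x in D) f x <= \int[P]_(x in D) g x)%E.
Proof.
move=> mD mf mg fg; rewrite integralE [leRHS]integralE leeB//.
- apply: ge0_le_integral => //; [exact: measurable_funepos..|].
  move=> x Dx; apply: (@funepos_le _ _ D) => //; last exact/mem_set.
  by move=> y /set_mem; exact: fg.
- apply: ge0_le_integral => //; [exact: measurable_funeneg..|].
  move=> x Dx; apply: (@funeneg_le _ _ D) => //; last exact/mem_set.
  by move=> y /set_mem; exact: fg.
Qed.

Lemma integrable_continuous (R : realType) (d : nat) (P : probability 'rV[R]_d R)
    (K : set 'rV[R]_d) (f : 'rV[R]_d -> R) :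
  compact K -> P K = 1%E -> continuous f -> P.-integrable setT (EFin \o f).
Proof.
move=> cK PK cf; have mf := continuous_rV_measurable cf.
have mK := compact_rV_measurable cK.
apply/integrableP; split; first exact/measurable_EFinP.
have mfE : measurable_fun setT (fun x => `|(f x)%:E|%E).
  by apply: measurableT_comp => //; exact/measurable_EFinP.
rewrite (integral_full_measure mK PK)//.
have /compact_bounded[M [_ hM]] : compact (f @` K).
  by apply: continuous_compact => //; exact: continuous_subspaceT.
apply: (@le_lt_trans _ _ (\int[P]_(x in K) (cst (`|M| + 1)%:E x))%E).
  apply: ge0_le_integral => //; first exact: measurable_funTS.
  move=> x Kx; rewrite /= lee_fin; apply: hM; last by exists x.
  by rewrite (le_lt_trans (ler_norm M))// ltrDl.
rewrite integral_cst// [X in (_ * X)%E](_ : _ = 1%E); last exact: PK.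
by rewrite mule1 ltry.
Qed.

Lemma dual_functional_le (R : realType) (d : nat)
    (rho mu : probability 'rV[R]_d R) (X Y : set 'rV[R]_d)
    (phi psi : 'rV[R]_d -> R) :
  compact X -> compact Y -> rho X = 1%E -> mu Y = 1%E ->
  continuous phi -> continuous psi -> conjugate_on Y phi psi ->
  (dual_functional rho mu phi
    <= (\int[rho]_x phi x + \int[mu]_y psi y)%:E)%E.
Proof.
move=> cX cY rX mY cphi cpsi h.
have ip := integrable_continuous cX rX cphi.
have iq := integrable_continuous cY mY cpsi.
rewrite EFinD /Rintegral !fineK; [|exact: integrable_fin_num..].
have mYs := compact_rV_measurable cY.
have mF := @measurable_fenchel_conjugate R d phi.
have mpsi : measurable_fun setT (fun y => (psi y)%:E).
  by apply/measurable_EFinP; exact: continuous_rV_measurable.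
rewrite /dual_functional leeD2l//.
rewrite (integral_full_measure mYs mY mF) (integral_full_measure mYs mY mpsi).
apply: measurable_le_integral => //; [exact: measurable_funTS..|].
by move=> y Yy; exact: fenchel_conjugate_le h Yy.
Qed.

Lemma dual_functional_ge (R : realType) (d : nat)
    (rho mu : probability 'rV[R]_d R) (X Y : set 'rV[R]_d)
    (phi psi : 'rV[R]_d -> R) :
  compact X -> compact Y -> rho X = 1%E -> mu Y = 1%E ->
  continuous phi -> continuous psi -> conjugate_on X psi phi ->
  ((\int[rho]_x phi x + \int[mu]_y psi y)%:E
    <= dual_functional rho mu phi)%E.
Proof.
move=> cX cY rX mY cphi cpsi h.
have ip := integrable_continuous cX rX cphi.
have iq := integrable_continuous cY mY cpsi.
rewrite EFinD /Rintegral !fineK; [|exact: integrable_fin_num..].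
rewrite /dual_functional leeD2l//.
apply: measurable_le_integral => //.
- by apply/measurable_EFinP; exact: continuous_rV_measurable.
- exact: measurable_fenchel_conjugate.
- by move=> y _; exact: fenchel_conjugate_ge h.
Qed.

Lemma measurable_enormB (R : realType) (d : nat) :
  measurable_fun setT (fun p : 'rV[R]_d * 'rV[R]_d => enorm (p.1 - p.2)).
Proof.
rewrite (_ : (fun p => _) = Num.sqrt \o (fun p : 'rV[R]_d * 'rV[R]_d =>
    \sum_(i < d) (p.1 0 i - p.2 0 i) ^+ 2)); last first.
  apply/funext => p; congr Num.sqrt.
  by apply: eq_bigr => i _; rewrite !mxE expr2.
apply: measurableT_comp.
  by apply: continuous_measurable_fun; exact: sqrt_continuous.
apply: measurable_sum => i; apply: measurable_funX.
have mi : measurable_fun setT (fun x : 'rV[R]_d => x 0 i).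
  by apply: continuous_rV_measurable; exact: coord_continuous.
by apply: measurable_funB; apply: (measurableT_comp mi).
Qed.

(** The marginal conditions of a coupling turn integrals over one factor into
    integrals over the product. *)
Lemma ge0_integral_marginal (d1 d2 : measure_display)
    (T1 : measurableType d1) (T2 : measurableType d2) (R : realType)
    (g : {measure set T1 -> \bar R}) (rho : {measure set T2 -> \bar R})
    (phi : T1 -> T2) (f : T2 -> \bar R) :
  measurable_fun setT phi ->
  (forall A, measurable A -> pushforward g phi A = rho A) ->
  measurable_fun setT f -> (forall x, 0 <= f x)%E ->
  (\int[rho]_x f x = \int[g]_x f (phi x))%E.
Proof.
move=> mphi gr mf f0.
have [pm pmE] : exists pm : {measure set T2 -> \bar R},
    (pm : set T2 -> \bar R) = pushforward g phi.
  by unshelve eexists (pushforward g phi).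
transitivity (\int[pm]_x f x)%E.
  apply: eq_measure_integral => A mA _; rewrite -gr//.
  exact: (congr1 (fun F : set T2 -> \bar R => F A) (esym pmE)).
by rewrite pmE ge0_integral_pushforward// preimage_setT.
Qed.

Lemma integrable_marginal (d1 d2 : measure_display)
    (T1 : measurableType d1) (T2 : measurableType d2) (R : realType)
    (g : {measure set T1 -> \bar R}) (rho : {measure set T2 -> \bar R})
    (phi : T1 -> T2) (f : T2 -> \bar R) :
  measurable_fun setT phi ->
  (forall A, measurable A -> pushforward g phi A = rho A) ->
  rho.-integrable setT f ->
  g.-integrable setT (f \o phi) /\
  (\int[rho]_x f x = \int[g]_x f (phi x))%E.
Proof.
move=> mphi gr /integrableP[mf fi]; split.
  apply/integrableP; split; first exact: measurableT_comp.
  rewrite (@ge0_integral_marginal _ _ _ _ _ g _ phi) in fi => //.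
  exact: measurableT_comp.
rewrite [LHS]integralE [RHS]integralE; congr (_ - _)%E.
- rewrite (@ge0_integral_marginal _ _ _ _ _ g _ phi)//.
  by apply: eq_integral => x _; rewrite !funeposE.
  exact: measurable_funepos.
- rewrite (@ge0_integral_marginal _ _ _ _ _ g _ phi)//.
  by apply: eq_integral => x _; rewrite !funenegE.
  exact: measurable_funeneg.
Qed.

(** The easy half of Kantorovich-Rubinstein duality. *)
Lemma Rintegral_lipschitz_W1 (R : realType) (d : nat)
    (rho mu : probability 'rV[R]_d R) (X : set 'rV[R]_d)
    (f : 'rV[R]_d -> R) (K : R) :
  compact X -> rho X = 1%E -> mu X = 1%E -> continuous f -> 0 < K ->
  (forall x y, f x - f y <= enorm (x - y) * K) ->
  ((\int[rho]_x f x - \int[mu]_x f x)%:E <= K%:E * W1 rho mu)%E.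
Proof.
move=> cX rX mX cf K0 hf.
have ir := integrable_continuous cX rX cf.
have im := integrable_continuous cX mX cf.
rewrite -lee_pdivrMl//; apply: le_ereal_inf_tmp => _ [g hg <-].
rewrite lee_pdivrMl//.
have gr A : measurable A -> pushforward g fst A = rho A by move=> /hg[].
have gm A : measurable A -> pushforward g snd A = mu A by move=> /hg[].
have mE : measurable_fun setT (fun p : 'rV[R]_d * 'rV[R]_d => (enorm (p.1 - p.2))%:E).
  by apply/measurable_EFinP; exact: measurable_enormB.
have [i1 e1] := integrable_marginal measurable_fst gr ir.
have [i2 e2] := integrable_marginal measurable_snd gm im.
rewrite EFinB /Rintegral !fineK; [|exact: integrable_fin_num..].
rewrite e1 e2 -integralB// -ge0_integralZl//; last first.
- by rewrite lee_fin ltW.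
- by move=> p _; rewrite lee_fin enorm_ge0.
apply: measurable_le_integral => //.
- by have /measurable_int := integrableB measurableT i1 i2.
- exact: measurable_funeM.
by move=> p _; rewrite /= -EFinB -EFinM lee_fin mulrC hf.
Qed.

(** The function h is a competitor for the first dual problem and phi0 for the
    second one. *)
Lemma stability_gap (R : realType) (d : nat) (X Y : set 'rV[R]_d)
    (rho0 rho1 mu0 mu1 : probability 'rV[R]_d R)
    (phi0 phi1 psi0 psi1 h : 'rV[R]_d -> R) :
  compact X -> compact Y -> rho0 X = 1%E -> rho1 X = 1%E -> mu0 Y = 1%E -> mu1 Y = 1%E ->
  brenier_potential rho0 mu0 phi0 -> dual_pair X Y phi0 psi0 ->
  brenier_potential rho1 mu1 phi1 -> dual_pair X Y phi1 psi1 ->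
  0 < ediam X -> 0 < ediam Y ->
  conjugate_on Y h (fun y => (psi0 y + psi1 y) / 2) ->
  (\int[rho0]_x (phi0 x + phi1 x - 2 * h x)%:E <=
    (ediam Y)%:E * W1 rho0 rho1 + (ediam X)%:E * W1 mu0 mu1)%E.
Proof.
move=> cX cY r0 r1 m0 m1 [_ min0] dp0 [_ min1] dp1 DX DY hh.
have [cphi0 cpsi0] := dual_pair_continuous cX cY dp0.
have [cphi1 cpsi1] := dual_pair_continuous cX cY dp1.
have ch := conjugate_continuous cY hh.
have [f0 g0] := dual_pair_conjugate dp0; have [f1 g1] := dual_pair_conjugate dp1.
have [sf0 sg0] := dual_pair_subgradient cX cY dp0.
have [sf1 sg1] := dual_pair_subgradient cX cY dp1.
have cD (f g : 'rV[R]_d -> R) : continuous f -> continuous g ->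
    continuous (fun x : 'rV[R]_d => f x + g x : R).
  by move=> cf cg x; apply: (@continuousD _ _ _ f g); [exact: cf|exact: cg].
have cB (f g : 'rV[R]_d -> R) : continuous f -> continuous g ->
    continuous (fun x : 'rV[R]_d => f x - g x : R).
  by move=> cf cg x; apply: (@continuousB _ _ _ f g); [exact: cf|exact: cg].
have cZ (a : R) (f : 'rV[R]_d -> R) : continuous f -> continuous (fun x : 'rV[R]_d => a * f x : R).
  by move=> cf x; apply: (@continuousM _ _ (cst a) f); [exact: cst_continuous|exact: cf].
have csum := cD _ _ cphi0 cphi1; have cpsum := cD _ _ cpsi0 cpsi1.
have cdphi := cB _ _ cphi1 cphi0; have cdpsi := cB _ _ cpsi1 cpsi0.
have c2h := cZ 2 _ ch; have cG := cB _ _ csum c2h.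
have cpsih : continuous (fun y => (psi0 y + psi1 y) / 2).
  rewrite (_ : (fun y => _) = (fun y => 2^-1 * (psi0 y + psi1 y))); first exact: cZ.
  by apply/funext => y; rewrite mulrC.
have ineq0 := le_trans (dual_functional_ge cX cY r0 m0 cphi0 cpsi0 g0)
  (le_trans (min0 _ (conjugate_convex hh)) (dual_functional_le cX cY r0 m0 ch cpsih hh)).
have ineq1 := le_trans (dual_functional_ge cX cY r1 m1 cphi1 cpsi1 g1)
  (le_trans (min1 _ (conjugate_convex f0)) (dual_functional_le cX cY r1 m1 cphi0 cpsi0 f0)).
rewrite lee_fin in ineq0; rewrite lee_fin in ineq1.
have lipphi x y : phi1 x - phi0 x - (phi1 y - phi0 y) <= enorm (x - y) * ediam Y.
  have := subgradient_slope y y (x - y) cY sf1 sf0.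
  rewrite addrCA subrr addr0; lra.
have lippsi x y : psi1 x - psi0 x - (psi1 y - psi0 y) <= enorm (x - y) * ediam X.
  have := subgradient_slope y y (x - y) cX sg1 sg0.
  rewrite addrCA subrr addr0; lra.
have W1 := Rintegral_lipschitz_W1 cX r0 r1 cdphi DY lipphi.
have W2 := Rintegral_lipschitz_W1 cY m0 m1 cdpsi DX lippsi.
apply: le_trans (leeD W1 W2).
have ir0 f : continuous f -> rho0.-integrable setT (EFin \o f)
  by exact: (integrable_continuous cX r0).
have ir1 f : continuous f -> rho1.-integrable setT (EFin \o f)
  by exact: (integrable_continuous cX r1).
have im0 f : continuous f -> mu0.-integrable setT (EFin \o f)
  by exact: (integrable_continuous cY m0).
have im1 f : continuous f -> mu1.-integrable setT (EFin \o f)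
  by exact: (integrable_continuous cY m1).
rewrite -[leLHS]fineK; last exact: (integrable_fin_num measurableT (ir0 _ cG)).
rewrite -EFinD lee_fin -/(Rintegral rho0 setT (fun x => phi0 x + phi1 x - 2 * h x)).
rewrite (RintegralB measurableT (ir0 _ csum) (ir0 _ c2h)).
rewrite (RintegralD measurableT (ir0 _ cphi0) (ir0 _ cphi1)).
rewrite (RintegralZl _ measurableT (ir0 _ ch)).
rewrite (RintegralB measurableT (ir0 _ cphi1) (ir0 _ cphi0)).
rewrite (RintegralB measurableT (ir1 _ cphi1) (ir1 _ cphi0)).
rewrite (RintegralB measurableT (im0 _ cpsi1) (im0 _ cpsi0)).
rewrite (RintegralB measurableT (im1 _ cpsi1) (im1 _ cpsi0)).
have mh : \int[mu0]_y ((psi0 y + psi1 y) / 2) =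
    2^-1 * (\int[mu0]_y psi0 y + \int[mu0]_y psi1 y).
  rewrite -(RintegralD measurableT (im0 _ cpsi0) (im0 _ cpsi1)).
  rewrite -(RintegralZl _ measurableT (im0 _ cpsum)).
  by congr Rintegral; apply/funext => y; rewrite mulrC.
rewrite mh in ineq0; lra.
Qed.

(** * Differentiability almost everywhere *)

(** The remainder F(t) = f(x + t e_i) - f(x) - t p_i is nonnegative and, by
    convexity, at most |t| / h times the second difference with step h when
    |t| <= h. *)
Lemma partial_eq_subgradient (R : realType) (d : nat) (f : 'rV[R]_d -> R)
    (hf : forall c, exists p, subgradient f c p) (x p : 'rV[R]_d) (i : 'I_d) :
  subgradient f x p ->
  (forall e, 0 < e -> exists2 h, 0 < h &
    second_diff f x (h *: delta_mx 0 i) <= h * e) ->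
  'D_(delta_mx 0 i) f x = p 0 i.
Proof.
move=> hp hs; apply/cvg_lim => //; apply/cvgrPdist_le => e e0.
have [h h0 he] := hs e e0.
near=> t.
have t0 : t != 0 by near: t; exact: nbhs_dnbhs_neq.
have th : `|t| < h by near: t; exact: dnbhs0_lt.
have tp : 0 < `|t| by rewrite normr_gt0.
set w := t *: delta_mx 0 i : 'rV[R]_d.
have wE l : w 0 l = if l == i then t else 0.
  by rewrite !mxE eqxx /= mulr_natr mulrb.
have low := hp (x + w); rewrite (_ : x + w - x = w) in low; last first.
  by rewrite addrAC subrr add0r.
have wp : dotp w p = t * p 0 i by rewrite dotpZl dotp_delta.
have up := le_cross_polytope hf (w := w) hp h0.
rewrite (bigD1 i)//= big1 in up; last by move=> l li; rewrite wE (negbTE li) normr0.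
rewrite (bigD1 i)//= [X in _ + (_ + X)]big1 in up; last first.
  by move=> l li; rewrite wE (negbTE li) normr0 !mul0r.
rewrite wE eqxx !addr0 in up; have {}up := up (ltW th).
rewrite wp in low; rewrite wp in up.
have {}up : f (x + w) <= f x + t * p 0 i + `|t| * e.
  apply: le_trans up _; rewrite lerD2l -mulrA ler_wpM2l//.
  by rewrite ler_pdivrMl.
rewrite /= (addrC w) /GRing.scale /= -(ler_pM2l tp) -normrM.
rewrite mulrBr mulVKf// ler_norml; lra.
Unshelve. all: by end_near. Qed.

Import HBNNSimple.

(** The integral of a nonnegative function is a supremum over the simple functions
    below it, and these are measurable. This makes the comparison available for the
    gradient, which is only known as a limit at each point. *)
Lemma ge0_le_integral_ae (dT : measure_display) (T : measurableType dT)
    (R : realType) (P : {measure set T -> \bar R}) (f g : T -> \bar R) :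
  (forall x, 0 <= f x)%E -> (forall x, 0 <= g x)%E -> measurable_fun setT g ->
  {ae P, forall x, (f x <= g x)%E} ->
  (\int[P]_x f x <= \int[P]_x g x)%E.
Proof.
move=> f0 g0 mg fg; rewrite ge0_integralTE//.
apply: ge_ereal_sup => _ [h /= hf <-].
rewrite -integralT_nnsfun.
apply: ae_ge0_le_integral => //.
- by move=> x _; rewrite lee_fin; exact: fun_ge0.
- exact/measurable_EFinP.
- by apply: filterS fg => x fgx _; exact: le_trans (hf x) fgx.
Qed.

(** The sequence D / (m + 1) serves as a radius that tends to 0. *)
Lemma le0_of_powR_bound (R : realType) (a C D theta : R) :
  0 < theta -> 0 < D -> 0 <= C ->
  (forall m : nat, a <= C * (D / m.+1%:R) `^ theta) -> a <= 0.
Proof.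
move=> t0 D0 C0 h; rewrite leNgt; apply/negP => a0.
have C1 : 0 < C + 1 by lra.
pose r := (a / (C + 1)) `^ theta^-1.
have r0 : 0 < r by rewrite powR_gt0// divr_gt0.
have rt : r `^ theta = a / (C + 1).
  by rewrite -powRrM mulVf ?gt_eqF// powRr1// divr_ge0// ltW.
have /andP[_ m1] := truncn_itv (ltW (divr_gt0 D0 r0)).
have := h (Num.truncn (D / r)); set m := Num.truncn _ in m1 *.
have m0 : 0 < m.+1%:R :> R by rewrite ltr0n.
have Dm : D / m.+1%:R <= r.
  by rewrite ler_pdivrMr// mulrC -ler_pdivrMr// ltW.
have : (D / m.+1%:R) `^ theta <= a / (C + 1).
  by rewrite -rt ge0_ler_powR// ?nnegrE ?divr_ge0 ?(ltW D0)// ltW.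
move=> h1 h2; have := le_trans h2 (ler_wpM2l C0 h1).
by rewrite mulrA ler_pdivlMr// mulrDr mulr1 mulrC; lra.
Qed.

(** By Markov's inequality, the set where the i-th difference quotient at scale r
    exceeds a fixed threshold has mass O(r^theta). The exceptional set is a
    countable union of intersections of such sets over r -> 0. *)
Lemma ae_small_second_diff (R : realType) (d : nat) (rho : probability 'rV[R]_d R)
    (X : set 'rV[R]_d) (D K theta : R) (f : 'rV[R]_d -> R) :
  measurable X -> continuous f -> 0 < theta -> 0 < D -> 0 <= K ->
  (forall r, 0 < r -> r <= D -> exists H : 'rV[R]_d -> R,
    [/\ measurable_fun setT H, forall x, 0 <= H x,
      forall x v, X x -> enorm v <= r -> second_diff f x v <= r * H x &
      (\int[rho]_x (H x)%:E <= (K * r `^ theta)%:E)%E]) ->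
  {ae rho, forall x, X x -> forall i e, 0 < e ->
    exists2 h, 0 < h & second_diff f x (h *: delta_mx 0 i) <= h * e}.
Proof.
move=> mX cf t0 D0 K0 key.
suff main (i : 'I_d) (m : nat) : {ae rho, forall x, X x ->
    exists2 h, 0 < h & second_diff f x (h *: delta_mx 0 i) <= h * m.+1%:R^-1}.
  have main' (i : 'I_d) := ae_foralln (main i).
  have : {ae rho, forall x, forall (i : 'I_d) (m : nat), X x ->
    exists2 h, 0 < h & second_diff f x (h *: delta_mx 0 i) <= h * m.+1%:R^-1}.
    by apply: filter_forall => i; exact: main'.
  apply: filterS => x hx Xx i e e0.
  have [h h0 hh] := hx i (Num.truncn e^-1) Xx; exists h => //.
  apply: le_trans hh _; rewrite ler_pM2l// invf_ple ?posrE//.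
  by have /andP[_ /ltW] := truncn_itv (ltW (etrans (invr_gt0 e) e0)).
pose r (k : nat) := D / k.+1%:R.
have r0 k : 0 < r k by rewrite divr_gt0.
have rD k : r k <= D by rewrite ler_pdivrMr// ler_peMr ?ler1n// ltW.
pose A k := X `&` [set x | r k / m.+1%:R <= second_diff f x (r k *: delta_mx 0 i)].
have mA k : measurable (A k).
  apply: measurableI => //.
  have ms : measurable_fun setT (fun x : 'rV[R]_d => second_diff f x (r k *: delta_mx 0 i)).
    have tr (v : 'rV[R]_d) : measurable_fun setT (fun x : 'rV[R]_d => f (x + v)).
      apply: continuous_rV_measurable => x.
      apply: (@continuous_comp _ _ _ (fun x : 'rV[R]_d => x + v) f); last exact: cf.
      by apply: (@continuousD _ _ _ idfun (cst v)); [exact: cvg_id|exact: cst_continuous].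
    apply: measurable_funB; first by apply: measurable_funD; exact: tr.
    by apply: measurable_funM => //; exact: continuous_rV_measurable.
  rewrite -[X in measurable X]setTI.
  rewrite (_ : [set x | _] = (fun x => second_diff f x (r k *: delta_mx 0 i)) @^-1`
    `[r k / m.+1%:R, +oo[%classic).
    by apply: ms => //; exact: measurable_itv.
  by apply/seteqP; split => x /=; rewrite in_itv /= andbT.
have bA k : (rho (A k) <= (m.+1%:R * K * r k `^ theta)%:E)%E.
  have [H [mH H0 hH iH]] := key (r k) (r0 k) (rD k).
  rewrite -mulrA EFinM -lee_pdivrMl//; apply: le_trans iH.
  rewrite -[in leLHS](setIT (A k)) -integral_indic// -ge0_integralZl//; last first.
    by apply/measurable_EFinP; exact: measurable_indic.
  apply: ge0_le_integral => //.
  - by apply: measurable_funeM; apply/measurable_EFinP; exact: measurable_indic.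
  - exact/measurable_EFinP.
  move=> x _; rewrite -EFinM lee_fin indicE; case: (boolP (x \in A k)); last first.
    by rewrite mulr0.
  rewrite in_setE => -[Xx /= Ax]; rewrite mulr1 -(ler_pM2l (r0 k)).
  apply: le_trans Ax (hH _ _ Xx _).
  rewrite enormZ (gtr0_norm (r0 k)) ler_piMr ?(ltW (r0 k))//.
  rewrite -(@ler_pXn2r _ 2)// ?nnegrE ?enorm_ge0// sqr_enorm dotp_delta.
  by rewrite mxE !eqxx expr1n.
exists (\bigcap_k A k); split; first exact: bigcapT_measurable.
- have Bfin : rho (\bigcap_k A k) \is a fin_num by exact: fin_num_measure (bigcapT_measurable mA).
  apply/eqP; rewrite eq_le measure_ge0 andbT -(fineK Bfin) lee_fin.
  apply: (@le0_of_powR_bound _ _ (m.+1%:R * K) D theta) => //; first by rewrite mulr_ge0.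
  move=> k; rewrite -lee_fin fineK//; apply: le_trans (bA k).
  by apply: le_measure; rewrite ?inE//; [exact: bigcapT_measurable|exact: bigcap_inf].
- move=> x /= /not_implyP[Xx nx] k _; split => //=.
  rewrite leNgt; apply/negP => lt; apply: nx; exists (r k) => //.
  exact: ltW.
Qed.

Lemma enorm_delta (R : realType) (d : nat) (i : 'I_d) :
  enorm (delta_mx 0 i : 'rV[R]_d) = 1.
Proof. by rewrite /enorm dotp_delta mxE !eqxx sqrtr1. Qed.

Lemma full_measure_nonempty (R : realType) (d : nat) (X : set 'rV[R]_d)
    (rho : probability 'rV[R]_d R) : rho X = 1%E -> X !=set0.
Proof.
move=> rX; apply/set0P/negP => /eqP X0; move: rX; rewrite X0 measure0 => /eqP.
by rewrite eq_sym onee_eq0.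
Qed.

Lemma ae_full_measure (R : realType) (d : nat) (X : set 'rV[R]_d)
    (rho : probability 'rV[R]_d R) :
  measurable X -> rho X = 1%E -> {ae rho, forall x, X x}.
Proof.
move=> mX rX; exists (~` X); split; first exact: measurableC.
  by have := probability_setC rho mX; rewrite rX subee.
by move=> x.
Qed.

(** Subgradients exist everywhere, and where the second differences are o(h) they
    agree with the vector of partial derivatives. *)
Lemma ae_gradient (R : realType) (n : nat) (X Y : set 'rV[R]_n.+1) (M theta : R)
  (rho : probability 'rV[R]_n.+1 R) (f : 'rV[R]_n.+1 -> R) :
  compact X -> compact Y -> 0 < M -> 0 < theta -> rho X = 1%E -> 0 < ediam X ->
  (forall (x : 'rV[R]_n.+1) (eta : R), 0 < eta ->
     (rho (eball x eta) <= (M * eta `^ (n.+1%:R - 1 + theta))%:E)%E) ->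
  continuous f -> (forall x, exists2 p, Y p & subgradient f x p) ->
  {ae rho, forall x, Y (gradient f x) /\ subgradient f x (gradient f x)}.
Proof.
move=> cX cY M0 t0 rX DX hball cf sf.
have sf' c : exists p, subgradient f c p by have [p _ hp] := sf c; exists p.
have [x0 Xx0] := full_measure_nonempty rX.
pose K := 8 * n.+1%:R ^+ 2 * 5 ^+ n * M * ediam Y * ediam X ^+ n.
have K0 : 0 <= K.
  have [p Yp _] := sf x0; have Y0 := le_trans (enorm_ge0 _) (le_ediam cY Yp Yp).
  by rewrite !mulr_ge0 ?exprn_ge0// ltW.
have mX := compact_rV_measurable cX.
have slope i x y L : 0 <= L -> f (x + L *: delta_mx 0 i) - f x -
    (f (y + L *: delta_mx 0 i) - f y) <= L * ediam Y.
  move=> L0; have := subgradient_slope x y (L *: delta_mx 0 i) cY sf sf.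
  by rewrite enormZ (ger0_norm L0) enorm_delta mulr1.
have key s : 0 < s -> s <= ediam X -> exists H : 'rV[R]_n.+1 -> R,
    [/\ measurable_fun setT H, forall x, 0 <= H x,
      forall x v, X x -> enorm v <= s -> second_diff f x v <= s * H x &
      (\int[rho]_x (H x)%:E <= (K * s `^ theta)%:E)%E].
  move=> s0 sD; have [H [mH H0 hH iH]] :=
    second_diff_integral_bound x0 hball sf' slope M0 s0 sD.
  by exists H; split => // x v Xx; apply: hH; exact: le_ediam.
have := ae_small_second_diff mX cf t0 DX K0 key.
move: (ae_full_measure mX rX); apply: filterS2 => x Xx sx; have {}sx := sx Xx.
have [p Yp hp] := sf x.
suff -> : gradient f x = p by [].
apply/rowP => i; rewrite mxE; apply: partial_eq_subgradient => // e e0.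
exact: sx.
Qed.

(** The factor 16 is twice that of the second difference estimate, since the slopes
    of phi0 + phi1 vary by at most 2 D_Y. *)
Lemma gradient_difference_bound (R : realType) (n : nat)
  (q : R) (X Y : set 'rV[R]_n.+1) (M theta r : R)
  (rho0 rho1 mu0 mu1 : probability 'rV[R]_n.+1 R)
  (phi0 phi1 psi0 psi1 : 'rV[R]_n.+1 -> R) :
  1 <= q -> compact X -> compact Y -> 0 < M -> 0 < theta ->
  rho0 X = 1%E -> rho1 X = 1%E -> mu0 Y = 1%E -> mu1 Y = 1%E ->
  (forall (x : 'rV[R]_n.+1) (eta : R), 0 < eta ->
     (rho0 (eball x eta) <= (M * eta `^ (n.+1%:R - 1 + theta))%:E)%E) ->
  brenier_potential rho0 mu0 phi0 -> dual_pair X Y phi0 psi0 ->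
  brenier_potential rho1 mu1 phi1 -> dual_pair X Y phi1 psi1 ->
  0 < ediam X -> 0 < ediam Y -> 0 < r -> r <= ediam X ->
  (\int[rho0]_x (enorm (gradient phi0 x - gradient phi1 x) `^ q)%:E <=
   (ediam Y `^ (q - 1))%:E *
     ((r^-1)%:E * ((ediam Y)%:E * W1 rho0 rho1 + (ediam X)%:E * W1 mu0 mu1) +
      (16 * n.+1%:R ^+ 2 * 5 ^+ n * M * ediam Y * ediam X ^+ n * r `^ theta)%:E))%E.
Proof.
move=> q1 cX cY M0 t0 rX0 rX1 mY0 mY1 hball b0 dp0 b1 dp1 DX DY r0 rD.
have [f0 _] := dual_pair_conjugate dp0; have [f1 _] := dual_pair_conjugate dp1.
have [sf0 _] := dual_pair_subgradient cX cY dp0.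
have [sf1 _] := dual_pair_subgradient cX cY dp1.
have [cphi0 _] := dual_pair_continuous cX cY dp0.
have [cphi1 _] := dual_pair_continuous cX cY dp1.
have [h hh hle] := conjugate_midpoint f0 f1.
have gap := stability_gap cX cY rX0 rX1 mY0 mY1 b0 dp0 b1 dp1 DX DY hh.
pose Phi x := phi0 x + phi1 x.
have sPhi c : exists p, subgradient Phi c p.
  have [p _ hp] := sf0 c; have [p' _ hp'] := sf1 c; exists (p + p') => x.
  by have := hp x; have := hp' x; rewrite dotpDr /Phi; lra.
have slope i x y L : 0 <= L -> Phi (x + L *: delta_mx 0 i) - Phi x -
    (Phi (y + L *: delta_mx 0 i) - Phi y) <= L * (2 * ediam Y).
  move=> L0; have e1 : enorm (L *: delta_mx 0 i : 'rV[R]_n.+1) = L.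
    by rewrite enormZ (ger0_norm L0) enorm_delta mulr1.
  have := subgradient_slope x y (L *: delta_mx 0 i) cY sf0 sf0.
  have := subgradient_slope x y (L *: delta_mx 0 i) cY sf1 sf1.
  by rewrite e1 /Phi; lra.
have [x0 Xx0] := full_measure_nonempty rX0.
have xX x : X x -> enorm (x - x0) <= ediam X by move=> Xx; exact: le_ediam.
have [H [mH H0 hH iH]] := second_diff_integral_bound x0 hball sPhi slope M0 r0 rD.
pose G x := phi0 x + phi1 x - 2 * h x.
have G0 x : 0 <= G x by have := hle x 0; rewrite subr0 addr0 /G; lra.
have mG : measurable_fun setT G.
  apply: measurable_funB.
    by apply: measurable_funD; exact: continuous_rV_measurable.
  apply: measurable_funM => //.
  by apply: continuous_rV_measurable; exact: conjugate_continuous hh.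
pose B x := r^-1 * G x + H x.
have B0 x : 0 <= B x by rewrite addr_ge0// mulr_ge0// invr_ge0 ltW.
have pointwise : {ae rho0, forall x,
    enorm (gradient phi0 x - gradient phi1 x) `^ q <= ediam Y `^ (q - 1) * B x}.
  move: (ae_full_measure (compact_rV_measurable cX) rX0)
    (ae_gradient cX cY M0 t0 rX0 DX hball cphi0 sf0)
    (ae_gradient cX cY M0 t0 rX0 DX hball cphi1 sf1).
  apply: filterS3 => x Xx [Yp0 hp0] [Yp1 hp1].
  set p0 := gradient phi0 x in Yp0 hp0 *; set p1 := gradient phi1 x in Yp1 hp1 *.
  have [->|w0] := eqVneq p0 p1.
    rewrite subrr enorm0 powR0; last by rewrite gt_eqF// (lt_le_trans ltr01).
    by rewrite mulr_ge0// powR_ge0.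
  set w := p0 - p1; have wp : 0 < enorm w.
    rewrite lt_neqAle enorm_ge0 andbT eq_sym; apply: contra_neq w0 => /enorm_eq0.
    by move/eqP; rewrite subr_eq0 => /eqP.
  have wY : enorm w <= ediam Y by exact: le_ediam.
  have wB : enorm w <= B x.
    (* This direction turns p0 - p1 into its norm. *)
    pose v := (r / enorm w) *: w.
    have vr : enorm v <= r.
      rewrite enormZ ger0_norm ?divr_ge0 ?(ltW wp) ?(ltW r0)// mulfVK ?gt_eqF//.
    have vw : dotp v p0 - dotp v p1 = r * enorm w.
      rewrite -dotpBr dotpZl -/w -sqr_enorm; field; rewrite gt_eqF//.
    have h1 := hp0 (x + v); have h2 := hp1 (x - v).
    rewrite addrAC subrr add0r in h1; rewrite addrAC subrr add0r dotpNl in h2.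
    have h3 := hle x v; have h4 := hH x v (xX x Xx) vr.
    rewrite /B -(ler_pM2l r0) mulrDr mulVKf ?gt_eqF//.
    move: h4; rewrite /second_diff /Phi /G -vw; lra.
  rewrite -[in leLHS](subrK 1 q) [leLHS]powRD; last by rewrite (gt_eqF wp) implybT.
  rewrite powRr1 ?(ltW wp)// ler_pM ?powR_ge0 ?(ltW wp)//.
  by rewrite ge0_ler_powR ?nnegrE ?subr_ge0 ?(ltW wp) ?(ltW DY).
apply: (@le_trans _ _ (\int[rho0]_x (ediam Y `^ (q - 1) * B x)%:E)%E).
  apply: ge0_le_integral_ae.
  - by move=> x; rewrite lee_fin powR_ge0.
  - by move=> x; rewrite lee_fin mulr_ge0// powR_ge0.
  - apply/measurable_EFinP; apply: measurable_funM => //.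
    by apply: measurable_funD => //; apply: measurable_funM.
  by move: pointwise; apply: filterS => x hx; rewrite lee_fin.
under eq_integral do rewrite EFinM.
have mGE : measurable_fun setT (fun x => (G x)%:E) by exact/measurable_EFinP.
have mHE : measurable_fun setT (fun x => (H x)%:E) by exact/measurable_EFinP.
have mrG : measurable_fun setT (fun x => (r^-1)%:E * (G x)%:E)%E by exact: measurable_funeM.
have rV0 : 0 <= r^-1 by rewrite invr_ge0 ltW.
have -> : (fun x => (ediam Y `^ (q - 1))%:E * (B x)%:E)%E =
   (fun x => (ediam Y `^ (q - 1))%:E * ((r^-1)%:E * (G x)%:E + (H x)%:E))%E.
  by apply/funext => x; rewrite /B EFinD EFinM.
rewrite ge0_integralZl//; last 3 first.
- exact: emeasurable_funD.
- by move=> x _; rewrite adde_ge0 ?mule_ge0 ?lee_fin.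
- by rewrite lee_fin powR_ge0.
rewrite lee_wpmul2l ?lee_fin ?powR_ge0// ge0_integralD//; last 2 first.
- by move=> x _; rewrite mule_ge0 ?lee_fin.
- by move=> x _; rewrite lee_fin.
rewrite ge0_integralZl ?lee_fin//; last by move=> x _; rewrite lee_fin.
apply: leeD; first by rewrite lee_wpmul2l ?lee_fin.
apply: le_trans iH _; rewrite lee_fin le_eqVlt; apply/orP; left; apply/eqP; ring.
Qed.

Lemma gradient_difference_le_diam (R : realType) (n : nat)
  (q : R) (X Y : set 'rV[R]_n.+1) (M theta : R)
  (rho : probability 'rV[R]_n.+1 R) (phi0 phi1 : 'rV[R]_n.+1 -> R) :
  0 < q -> compact X -> compact Y -> 0 < M -> 0 < theta -> rho X = 1%E -> 0 < ediam X ->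
  (forall (x : 'rV[R]_n.+1) (eta : R), 0 < eta ->
     (rho (eball x eta) <= (M * eta `^ (n.+1%:R - 1 + theta))%:E)%E) ->
  continuous phi0 -> (forall x, exists2 p, Y p & subgradient phi0 x p) ->
  continuous phi1 -> (forall x, exists2 p, Y p & subgradient phi1 x p) ->
  (\int[rho]_x (enorm (gradient phi0 x - gradient phi1 x) `^ q)%:E
    <= (ediam Y `^ q)%:E)%E.
Proof.
move=> q0 cX cY M0 t0 rX DX hball c0 s0 c1 s1.
apply: (@le_trans _ _ (\int[rho]_x (cst (ediam Y `^ q)%:E x))%E).
  apply: ge0_le_integral_ae => //.
  - by move=> x; rewrite lee_fin powR_ge0.
  - by move=> x; rewrite lee_fin powR_ge0.
  move: (ae_gradient cX cY M0 t0 rX DX hball c0 s0)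
    (ae_gradient cX cY M0 t0 rX DX hball c1 s1).
  apply: filterS2 => x [Yp0 _] [Yp1 _]; have := le_ediam cY Yp0 Yp1 => h.
  by rewrite lee_fin ge0_ler_powR ?nnegrE ?enorm_ge0 ?(ltW q0)// (le_trans _ h)// enorm_ge0.
rewrite integral_cst// [X in (_ * X)%E](_ : _ = 1%E) ?mule1//.
exact: probability_setT.
Qed.

(** * Stability of the gradients *)

(** The powers combine as 6 ^ (n + 1) (5/6) ^ n = 6 5 ^ n, and n + 2 >= 3. *)
Lemma cst_c_ge (R : realType) (n : nat) : (0 < n)%N ->
  16 * n.+1%:R ^+ 2 * 5 ^+ n <= cst_c R n.+1.
Proof.
move=> n0.
pose a : R := 4 / 3 * (6 ^+ n.+1 * n.+1%:R ^+ 2 * (n.+1%:R + 1)).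
have -> : cst_c R n.+1 = a * (beta R n.+1 / beta R n) by rewrite /cst_c /a /= !mulrA.
have a0 : 0 <= a by rewrite /a !mulr_ge0 ?exprn_ge0 ?addr_ge0 ?invr_ge0.
apply: le_trans (ler_wpM2l a0 (beta_ratio_ge R n)).
have n1 : 1 <= n%:R :> R by rewrite ler1n.
have e : 6 ^+ n.+1 * (5 / 6) ^+ n = 6 * 5 ^+ n :> R.
  by rewrite exprS -mulrA -exprMn (_ : 6 * (5 / 6) = 5 :> R)//; field.
rewrite (_ : a * _ = (8 * (n.+1%:R + 1)) * (n.+1%:R ^+ 2 * 5 ^+ n)); last first.
  transitivity (4 / 3 * (6 ^+ n.+1 * (5 / 6) ^+ n) * (n.+1%:R ^+ 2 * (n.+1%:R + 1)) : R).
    by rewrite /a; ring.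
  by rewrite e; field.
rewrite -mulrA ler_wpM2r ?mulr_ge0 ?exprn_ge0// -[n.+1%:R]natr1; lra.
Qed.

(** Otherwise X is a point, which would be an atom of rho. *)
Lemma diam_gt0_of_ball_growth (R : realType) (d : nat) (X : set 'rV[R]_d)
    (rho : probability 'rV[R]_d R) (M s : R) :
  compact X -> rho X = 1%E -> 0 < M -> 0 < s ->
  (forall (x : 'rV[R]_d) (eta : R), 0 < eta ->
     (rho (eball x eta) <= (M * eta `^ s)%:E)%E) ->
  0 < ediam X.
Proof.
move=> cX rX M0 s0 hball.
have [x0 Xx0] := full_measure_nonempty rX.
rewrite ltNge; apply/negP => D0.
suff : (1 : R) <= 0 by rewrite ler10.
apply: (@le0_of_powR_bound _ _ M 1 s) => //; first exact: ltW.
move=> m; have m0 : 0 < 1 / m.+1%:R :> R by rewrite divr_gt0.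
rewrite -lee_fin; apply: le_trans (hball x0 _ m0).
rewrite -rX; apply: le_measure; rewrite ?inE;
  [exact: compact_rV_measurable|exact: eball_measurable|].
move=> x Xx; rewrite /eball /=; apply: le_lt_trans m0.
exact: le_trans (le_ediam cX Xx Xx0) D0.
Qed.

(** The radius is DX s with s ^ (1 + theta) = E / (DY DX), which makes E / r and
    DY s ^ theta equal. *)
Lemma optimal_radius (R : realType) (theta DX DY E : R) :
  0 < theta -> 0 < DX -> 0 < DY -> 0 < E -> E <= DY * DX ->
  exists2 r, 0 < r <= DX &
    E / r = DY * (E / (DY * DX)) `^ (theta / (1 + theta)) /\
    r `^ theta = DX `^ theta * (E / (DY * DX)) `^ (theta / (1 + theta)).
Proof.
move=> t0 DX0 DY0 E0 ED.
have t1 : 0 < 1 + theta by lra.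
have D0 : 0 < DY * DX by exact: mulr_gt0.
set u := E / (DY * DX); have u0 : 0 < u by rewrite divr_gt0.
have u1 : u <= 1 by rewrite ler_pdivrMr// mul1r.
pose s := u `^ (1 + theta)^-1.
have s0 : 0 < s by exact: powR_gt0.
have s1 : s <= 1.
  apply: (@le_trans _ _ (1 `^ (1 + theta)^-1)); last by rewrite powR1.
  by rewrite ge0_ler_powR ?nnegrE ?invr_ge0 ?(ltW u0) ?(ltW t1).
have st : s `^ theta = u `^ (theta / (1 + theta)).
  by rewrite -powRrM mulrC.
have su : s * s `^ theta = u.
  rewrite -{1}(powRr1 (ltW s0)) -powRD; last by rewrite (gt_eqF s0) implybT.
  by rewrite -powRrM mulVf ?gt_eqF// powRr1// ltW.
exists (DX * s); first by rewrite mulr_gt0//= ler_piMr// ltW.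
rewrite -st; split; last by rewrite powRM// ltW.
have -> : E = s * s `^ theta * (DY * DX) by rewrite su /u mulfVK// gt_eqF.
by field; rewrite !gt_eqF.
Qed.

Lemma W1_ge0 (R : realType) (d : nat) (rho mu : probability 'rV[R]_d R) :
  (0 <= W1 rho mu)%E.
Proof.
apply: le_ereal_inf_tmp => _ [g _ <-]; apply: integral_ge0 => p _.
by rewrite lee_fin enorm_ge0.
Qed.

(** Three regimes: if E >= D_Y D_X the bound by the diameter is enough, if E = 0 the
    radius tends to 0, and otherwise the radius is the balanced one. If D_Y = 0 all
    gradients agree almost everywhere. *)
Lemma gradient_stability (R : realType) (n : nat) (hn : (0 < n)%N)
  (q : R) (X Y : set 'rV[R]_n.+1) (M theta : R)
  (rho0 rho1 mu0 mu1 : probability 'rV[R]_n.+1 R)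
  (phi0 phi1 psi0 psi1 : 'rV[R]_n.+1 -> R) :
  1 <= q -> compact X -> compact Y -> 0 < M -> 0 < theta ->
  rho0 X = 1%E -> rho1 X = 1%E -> mu0 Y = 1%E -> mu1 Y = 1%E ->
  (forall (x : 'rV[R]_n.+1) (eta : R), 0 < eta ->
     (rho0 (eball x eta) <= (M * eta `^ (n.+1%:R - 1 + theta))%:E)%E) ->
  brenier_potential rho0 mu0 phi0 -> dual_pair X Y phi0 psi0 ->
  brenier_potential rho1 mu1 phi1 -> dual_pair X Y phi1 psi1 ->
  0 < ediam X ->
  (\int[rho0]_x (enorm (gradient phi0 x - gradient phi1 x) `^ q)%:E <=
   (ediam Y `^ q * (1 + cst_c R n.+1 * M * ediam X `^ (n.+1%:R - 1 + theta))
     * (ediam Y * ediam X) `^ (- (theta / (1 + theta))))%:E *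
   ((ediam Y)%:E * W1 rho0 rho1 + (ediam X)%:E * W1 mu0 mu1)
     `^ (theta / (1 + theta)))%E.
Proof.
move=> q1 cX cY M0 t0 rX0 rX1 mY0 mY1 hball b0 dp0 b1 dp1 DX0.
have [sf0 _] := dual_pair_subgradient cX cY dp0.
have [sf1 _] := dual_pair_subgradient cX cY dp1.
have [cphi0 _] := dual_pair_continuous cX cY dp0.
have [cphi1 _] := dual_pair_continuous cX cY dp1.
have q0 : 0 < q by exact: lt_le_trans q1.
have crude := gradient_difference_le_diam q0 cX cY M0 t0 rX0 DX0 hball cphi0 sf0 cphi1 sf1.
have c0 : 0 < cst_c R n.+1.
  by apply: lt_le_trans (cst_c_ge R hn); rewrite !mulr_gt0 ?exprn_gt0.
have [x0 _] := full_measure_nonempty rX0; have [p0 Yp0 _] := sf0 x0.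
have := le_trans (enorm_ge0 _) (le_ediam cY Yp0 Yp0).
rewrite le_eqVlt => /predU1P[DY0|DY0].
  apply: le_trans crude _; rewrite -DY0 powR0 ?gt_eqF// mule_ge0 ?poweR_ge0//.
  by rewrite lee_fin !mul0r.
have bound r := gradient_difference_bound (r := r) q1 cX cY M0 t0 rX0 rX1 mY0 mY1
  hball b0 dp0 b1 dp1 DX0 DY0.
set DX := ediam X in DX0 bound *; set DY := ediam Y in DY0 bound crude *.
set I := (\int[rho0]_x _)%E in bound crude *.
set E := (DY%:E * _ + _)%E in bound *.
set al := theta / (1 + theta).
have t1 : 0 < 1 + theta by lra.
have al0 : 0 < al by rewrite divr_gt0.
have cc := cst_c_ge R hn.
set cM := cst_c R n.+1 * M * DX `^ (n.+1%:R - 1 + theta).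
have DD : 0 < DY * DX by exact: mulr_gt0.
have cM0 : 0 <= cM.
  by apply: mulr_ge0; [apply: mulr_ge0; exact: ltW|exact: powR_ge0].
have E0 : (0 <= E)%E.
  by rewrite adde_ge0// mule_ge0 ?lee_fin ?W1_ge0// ltW.
have bound' r : 0 < r -> r <= DX ->
    (I <= (DY `^ (q - 1))%:E * ((r^-1)%:E * E
      + (cst_c R n.+1 * M * DY * DX ^+ n * r `^ theta)%:E))%E.
  move=> r0 rD; apply: le_trans (bound r r0 rD) _.
  rewrite lee_wpmul2l ?lee_fin ?powR_ge0// leeD2l// lee_fin.
  by rewrite !ler_wpM2r ?powR_ge0 ?exprn_ge0 ?(ltW DX0) ?(ltW DY0) ?(ltW M0).
have DYq : DY `^ (q - 1) * DY = DY `^ q.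
  rewrite -{2}(powRr1 (ltW DY0)) -powRD; last by rewrite (gt_eqF DY0) implybT.
  by rewrite subrK.
have DXn : DX `^ (n.+1%:R - 1 + theta) = DX ^+ n * DX `^ theta.
  rewrite -natr1 addrK powRD; last by rewrite (gt_eqF DX0) implybT.
  by rewrite powR_mulrn// ltW.
have DDal : 0 < (DY * DX) `^ (- al) by exact: powR_gt0.
have C0 : 0 < DY `^ q * (1 + cM) * (DY * DX) `^ (- al).
  by rewrite !mulr_gt0 ?powR_gt0// ltr_pwDl.
have quot e : 0 <= e -> (DY * DX) `^ (- al) * e `^ al = (e / (DY * DX)) `^ al.
  move=> e0; rewrite [RHS]powRM ?invr_ge0 ?(ltW DD)// [RHS]mulrC; congr (_ * _).
  by rewrite -powR_inv1 ?(ltW DD)// -powRrM mulN1r.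
move: E E0 bound' {bound} => [e| |]//; last first.
  by move=> _ _; rewrite poweRyr ?gt_eqF// gt0_muley ?leey// lte_fin.
rewrite lee_fin => e0 bound; rewrite poweR_EFin -EFinM -[leRHS]/(_%:E).
rewrite -(mulrA _ _ (e `^ al)) quot//.
have [e1|e1] := leP (DY * DX) e.
- apply: (@le_trans _ _ (DY `^ q)%:E); last first.
    rewrite lee_fin -mulrA ler_peMr ?powR_ge0//.
    rewrite -[leLHS]mulr1 ler_pM//; first by rewrite lerDl.
    apply: (@le_trans _ _ (1 `^ al)); first by rewrite powR1.
    have h : 1 <= e / (DY * DX) by rewrite ler_pdivlMr// mul1r.
    by rewrite ge0_ler_powR ?nnegrE// ?(ltW al0)// (le_trans ler01).
  exact: crude.
have [e00|en0] := eqVneq e 0.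
- rewrite e00 mul0r powR0 ?gt_eqF// mulr0.
  move: I {crude} bound => [i| |] bound; rewrite ?lee_fin ?leNye//.
  + pose K := DY `^ (q - 1) * (cst_c R n.+1 * M * DY * DX ^+ n).
    apply: (@le0_of_powR_bound _ _ K DX theta) => //.
      by rewrite ltW// /K !(c0, mulr_gt0, powR_gt0, exprn_gt0).
    move=> m; have m0 : 0 < DX / m.+1%:R by rewrite divr_gt0.
    have mD : DX / m.+1%:R <= DX by rewrite ler_pdivrMr// ler_peMr ?ler1n// ltW.
    rewrite -lee_fin; apply: le_trans (bound _ m0 mD) _.
    by rewrite e00 mule0 add0e -EFinM lee_fin /K -[leRHS]mulrA.
  + by have := bound DX DX0 (lexx _); rewrite e00 mule0 add0e -EFinM leye_eq.
have ep : 0 < e by rewrite lt_neqAle eq_sym en0.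
have [r /andP[r0 rD] [er rt]] := optimal_radius t0 DX0 DY0 ep (ltW e1).
apply: le_trans (bound r r0 rD) _.
rewrite -(EFinM r^-1) -EFinD -EFinM lee_fin (mulrC r^-1) er rt -/al.
rewrite -DYq /cM DXn le_eqVlt; apply/orP; left; apply/eqP; ring.
Qed.

Theorem theorem4p6 (R : realType) (d : nat) (hd : (2 <= d)%N)
  (q : R) (hq : 1 <= q)
  (X Y : set 'rV[R]_d) (hX : compact X) (hY : compact Y)
  (M : R) (hM : 0 < M) (theta : R) (htheta : 0 < theta <= 1)
  (rho0 : probability 'rV[R]_d R) (hrho0 : rho0 X = 1%E)
  (hball : forall (x : 'rV[R]_d) (eta : R), 0 < eta ->
     (rho0 (eball x eta) <= (M * eta `^ (d%:R - 1 + theta))%:E)%E)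
  (rho1 : probability 'rV[R]_d R) (hrho1 : rho1 X = 1%E)
  (mu0 mu1 : probability 'rV[R]_d R) (hmu0 : mu0 Y = 1%E) (hmu1 : mu1 Y = 1%E)
  (phi0 phi1 psi0 psi1 : 'rV[R]_d -> R)
  (hphi0 : brenier_potential rho0 mu0 phi0) (hpsi0 : dual_pair X Y phi0 psi0)
  (hphi1 : brenier_potential rho1 mu1 phi1) (hpsi1 : dual_pair X Y phi1 psi1) :
  let DX := ediam X in
  let DY := ediam Y in
  let C := DY `^ q * (1 + cst_c R d * M * DX `^ (d%:R - 1 + theta))
           * (DY * DX) `^ (- (theta / (1 + theta))) in
  ('N[rho0]_(q%:E)
     [(fun x => (enorm (gradient phi0 x - gradient phi1 x))%:E)] `^ q
   <= C%:E * (DY%:E * W1 rho0 rho1 + DX%:E * W1 mu0 mu1)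
             `^ (theta / (1 + theta)))%E.
Proof.
cbv zeta; have /andP[t0 _] := htheta.
case: d hd X Y hX hY rho0 hrho0 hball rho1 hrho1 mu0 mu1 hmu0 hmu1 phi0 phi1 psi0 psi1
  hphi0 hpsi0 hphi1 hpsi1 => [//|n] hn X Y hX hY rho0 hrho0 hball
  rho1 hrho1 mu0 mu1 hmu0 hmu1 phi0 phi1 psi0 psi1 hphi0 hpsi0 hphi1 hpsi1.
have q0 : 0 < q by exact: lt_le_trans hq.
have ns : 0 < n.+1%:R - 1 + theta :> R by rewrite -natr1 addrK ltr_wpDl.
have DX0 := diam_gt0_of_ball_growth hX hrho0 hM ns hball.
have -> : ('N[rho0]_(q%:E)
     [(fun x => (enorm (gradient phi0 x - gradient phi1 x))%:E)] `^ q =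
   \int[rho0]_x (enorm (gradient phi0 x - gradient phi1 x) `^ q)%:E)%E.
  rewrite unlock /= -poweRrM mulVf ?gt_eqF// poweRe1; last first.
    by apply: integral_ge0 => x _; rewrite lee_fin powR_ge0.
  by apply: eq_integral => x _; rewrite /= ger0_norm ?enorm_ge0.
exact: (gradient_stability hn hq hX hY hM t0 hrho0 hrho1 hmu0 hmu1 hball hphi0 hpsi0
  hphi1 hpsi1 DX0).
Qed.
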